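(* Let $n\ge 2$ be an even integer and let $\mathcal P$ be a convex class of probability densities on $\mathcal X$ with respect to $\mu$. Let $\varepsilon_{n/2}>0$ satisfy $$\frac n2\,\varepsilon_{n/2}^2\ \ge\ \max\{\log N_{\mathsf{loc}}(\mathcal P,\varepsilon_{n/2}),\,1\}.$$ Assume that there exist $\alpha\ge 2$ and an integer $N_S\ge1$ such that for every $p\in\mathcal P$ one can find a finite set $S(p)\subset\mathcal P\cap B_{\mathrm H^2}(p,\varepsilon_{n/2}^2)$ with $|S(p)|\le N_S$ which is an $\alpha$-ratio cover of $\mathcal P\cap B_{\mathrm H^2}(p,\varepsilon_{n/2}^2)$, meaning that for every $q\in\mathcal P\cap B_{\mathrm H^2}(p,\varepsilon_{n/2}^2)$ there exists $\tilde q\in S(p)$ with $q(x)\le\alpha\,\tilde q(x)$ for all $x\in\mathcal X$. Then there exists an estimator $\widehat p=\widehat p(X_1,\dots,X_n)$ such that for every $p^\star\in\mathcal P$, if $X_1,\dots,X_n$ are i.i.d. with density $p^\star$, then $$\mathbf E\big[\mathrm{KL}(p^\star,\widehat p)\big]\le 366609\,\varepsilon_{n/2}^2\log(\alpha)+\frac{\log(N_S)}{n/2+1}.$$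
   Context: The Hellinger distance $\mathrm H(p,q)\ge0$ is defined by $\mathrm H^2(p,q)=\frac12\int_{\mathcal X}(\sqrt p-\sqrt q)^2\,d\mu$, and $\mathrm{KL}(p,q)=\int_{\mathcal X}p\log(p/q)\,d\mu\in[0,+\infty]$. Balls: $B_{\mathrm H}(p,r)=\{q\text{ a density}:\mathrm H(p,q)\le r\}$ and $B_{\mathrm H^2}(p,r)=\{q\text{ a density}:\mathrm H^2(p,q)\le r\}$. For a set $\mathcal F$ of densities, $N_{\mathrm H}(\mathcal F,\varepsilon)$ is the covering number of $\mathcal F$ in the metric $\mathrm H$ at scale $\varepsilon$ (smallest cardinality of $\mathcal F_0\subset\mathcal F$ such that every $f\in\mathcal F$ is within $\mathrm H$-distance $\varepsilon$ of some element of $\mathcal F_0$). The local Hellinger entropy is $$N_{\mathsf{loc}}(\mathcal P,\varepsilon)=\sup_{p\in\mathcal P}\ \sup_{\eta\ge\varepsilon}N_{\mathrm H}\big(B_{\mathrm H}(p,\eta)\cap\mathcal P,\ \eta/2\big).$$ An estimator is a map from samples in $\mathcal X^n$ to probability densities on $(\mathcal X,\mu)$; it may depend on $\mathcal P$, $n$ and the other given quantities but not on $p^\star$. $\log$ is the natural logarithm. *)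

(* Defs.v *)
From HB Require Import structures.
From mathcomp Require Import all_boot all_order all_algebra.
From mathcomp Require Import all_classical all_reals all_analysis.

Set Implicit Arguments.
Unset Strict Implicit.
Unset Printing Implicit Defensive.

Import Order.TTheory GRing.Theory Num.Theory.
Import numFieldNormedType.Exports.

Local Open Scope classical_set_scope.
Local Open Scope card_scope.
Local Open Scope ring_scope.

(* Densities are genuine functions, not classes modulo mu-null sets: the ratio
   covers below compare them at every point. *)
Definition is_density {d} {T : measurableType d} {R : realType}
    (mu : {measure set T -> \bar R}) (p : T -> R) : Prop :=
  [/\ measurable_fun [set: T] p,
      forall x, 0 <= p x
    & (\int[mu]_x (p x)%:E = 1)%E].

(* [R^o] only selects the R-module structure of [T -> R]. *)
Definition convex_class {d} {T : measurableType d} {R : realType}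
    (P : set (T -> R)) : Prop :=
  @convex_set R (T -> R^o) P.

(* For densities the integrand is at most p + q, so that the integral is finite
   and the real-valued integral loses nothing. *)
Definition hellinger_sq {d} {T : measurableType d} {R : realType}
    (mu : {measure set T -> \bar R}) (p q : T -> R) : R :=
  2^-1 * \int[mu]_x (Num.sqrt (p x) - Num.sqrt (q x)) ^+ 2.

Definition hellinger {d} {T : measurableType d} {R : realType}
    (mu : {measure set T -> \bar R}) (p q : T -> R) : R :=
  Num.sqrt (hellinger_sq mu p q).

(* p log (p / q) with the conventions 0 log (0 / b) = 0 for every b >= 0 and
   a log (a / 0) = +oo for a > 0.  For densities the negative part of the
   integrand is at most q, so that the integral is well defined. *)
Definition KL {d} {T : measurableType d} {R : realType}
    (mu : {measure set T -> \bar R}) (p q : T -> R) : \bar R :=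
  (\int[mu]_x (if p x == 0%R then 0
               else if q x == 0%R then +oo
               else (p x * ln (p x / q x))%:E))%E.

Definition hellinger_ball {d} {T : measurableType d} {R : realType}
    (mu : {measure set T -> \bar R}) (p : T -> R) (r : R) : set (T -> R) :=
  [set q | is_density mu q /\ hellinger mu p q <= r].

Definition hellinger_sq_ball {d} {T : measurableType d} {R : realType}
    (mu : {measure set T -> \bar R}) (p : T -> R) (r : R) : set (T -> R) :=
  [set q | is_density mu q /\ hellinger_sq mu p q <= r].

(* [F0] has exactly [k] elements; the value is +oo when [F] has no finite
   [eps]-cover. *)
Definition covering_number {d} {T : measurableType d} {R : realType}
    (mu : {measure set T -> \bar R}) (F : set (T -> R)) (eps : R) : \bar R :=
  ereal_inf [set (k%:R)%:E | k in [set k : nat |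
    exists F0 : set (T -> R),
      [/\ F0 `<=` F, F0 #= `I_k
        & forall f, F f -> exists2 g, F0 g & hellinger mu f g <= eps]]].

Definition local_entropy {d} {T : measurableType d} {R : realType}
    (mu : {measure set T -> \bar R}) (P : set (T -> R)) (eps : R) : \bar R :=
  ereal_sup [set ereal_sup
      [set covering_number mu (hellinger_ball mu p eta `&` P) (eta / 2)
        | eta in [set eta : R | eps <= eta]]
    | p in P].

Definition ratio_cover {T : Type} {R : realType}
    (alpha : R) (F S : set (T -> R)) : Prop :=
  forall q, F q -> exists2 q', S q' & forall x, q x <= alpha * q' x.

Definition mutually_independent {d d'} {Omega : measurableType d'}
    {T : measurableType d} {R : realType} (Q : probability Omega R)
    (n : nat) (X : 'I_n -> {RV Q >-> T}) : Prop :=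
  forall (J : {set 'I_n}) (A : 'I_n -> set T),
    (forall i, measurable (A i)) ->
    (Q (\bigcap_(i in [set` J]) X i @^-1` A i)
     = \prod_(i in J) Q (X i @^-1` A i))%E.

Definition iid_with_density {d d'} {Omega : measurableType d'}
    {T : measurableType d} {R : realType} (mu : {measure set T -> \bar R})
    (p : T -> R) (Q : probability Omega R)
    (n : nat) (X : 'I_n -> {RV Q >-> T}) : Prop :=
  mutually_independent X /\
  forall i (A : set T), measurable A ->
    (distribution Q (X i) A = \int[mu]_(x in A) (p x)%:E)%E.

(* Joint measurability is what gives the risk of the estimator a meaning. *)
Definition is_estimator {d} {T : measurableType d} {R : realType}
    (mu : {measure set T -> \bar R}) (n : nat)
    (phat : n.-tuple T -> T -> R) : Prop :=
  measurable_fun [set: n.-tuple T * T] (fun z => phat z.1 z.2) /\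
  forall s, is_density mu (phat s).

(* Main.v *)
(* The sample is split into halves of size m = n/2.  On the first half, take a
   maximal eps-separated family in the class; by the local entropy bound at
   most exp (m eps^2 (l+1)) of its members lie within 2^l eps of a given one.
   Robust tests between all pairs of members (likelihood ratios of square roots
   bounded between 1/4 and 4) select a member p whose squared Hellinger
   distance to the truth has exponential tails at scale eps^2.  By convexity, a
   small step from p towards the true density p* stays in the covered ball, so
   that some q in S(p) dominates p* up to a factor alpha (2 + 2 v), where v is
   the squared distance divided by eps^2; hence KL(p*, q) is at most
   ln alpha times eps^2 times a quadratic polynomial in v, whose expectation is
   bounded.  On the second half, the progressive Bayes mixture over S(p) loses
   at most ln N_S / (m + 1) in Kullback-Leibler risk against the best q. *)

(* The truth need not belong to the separated family, so a test between two members has to behave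
   well under a third density. An unbounded likelihood ratio may have infinite expectation there;
   the bounded one has expectation at most 1 - (3/8) h2(p,q) + 16 h2(s,p) under any density s.
   Losses are measured from the member nearest to the truth, which makes them functions of a finite
   index. The union bound over shells converges because squared distances grow like 4^l while
   log-cardinalities grow linearly in l; beyond 64 eps^2 the tests win. The resulting constant is
   3/2 * [risk_profile 64] = 208290. As [mu] is an arbitrary measure, Fubini is applied only to laws
   under [Q], and the density is inserted afterwards. In the second stage all likelihoods are
   divided by that of the comparison member: the sums are then at least 1, their logarithms
   nonnegative, and the domination constant only has to make integrals finite. *)
Require Import Defs.
From HB Require Import structures.
From mathcomp Require Import all_boot all_order all_algebra ring lra zify.
From mathcomp Require Import all_classical all_reals all_analysis.
From mathcomp Require Import measurable_realfun.
Import Order.TTheory GRing.Theory Num.Theory.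
Import numFieldNormedType.Exports.

Set Implicit Arguments.
Unset Strict Implicit.
Unset Printing Implicit Defensive.

Local Open Scope classical_set_scope.
Local Open Scope card_scope.
Local Open Scope ring_scope.

(** * Elementary inequalities *)

(* [b / a] flattened to the range [1/4, 4], for [a] and [b] the square roots of
   two densities at a point. *)
Definition test_ratio {R : realType} (a b : R) : R :=
  if a + b == 0 then 1 else (b + a / 4) / (a + b / 4).

Section RealInequalities.
Context {R : realType}.
Implicit Types a b c p q r A : R.

Lemma test_ratio_gt0 a b : 0 <= a -> 0 <= b -> 0 < test_ratio a b.
Proof.
move=> a0 b0; rewrite /test_ratio; case: eqP => // /eqP ab.
by apply: divr_gt0; lra.
Qed.

Lemma test_ratioV a b : 0 <= a -> 0 <= b ->
  test_ratio b a = (test_ratio a b)^-1.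
Proof.
move=> a0 b0; rewrite /test_ratio addrC; case: eqP => [_|/eqP ab].
  by rewrite invr1.
by rewrite invf_div.
Qed.

(** Here [a], [b], [c] stand for the square roots of [p], [q] and the true density at a point. With
    [r] the ratio and [e = a (r - 1)], [c^2 r] is expanded around [c = a]. The term in [b^2 - a^2]
    is kept because it integrates to zero for densities. *)
Lemma test_ratio_le a b c : 0 <= a -> 0 <= b ->
  c ^+ 2 * test_ratio a b <= c ^+ 2 + 3 / 10 * (b ^+ 2 - a ^+ 2)
    - 3 / 16 * (b - a) ^+ 2 + 8 * (c - a) ^+ 2.
Proof.
move=> a0 b0; rewrite /test_ratio; case: eqP => [ab|/eqP ab].
  have -> : a = 0 by lra.
  have -> : b = 0 by lra.
  by nra.
have D0 : 0 < a + b / 4 by lra.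
set r := ((b + a / 4) / _).
have rD : r * (a + b / 4) = b + a / 4 by rewrite /r divfK // gt_eqF.
have r4 : r <= 4 by rewrite ler_pdivrMr //; lra.
pose e := a * (r - 1).
have eD : e * (a + b / 4) = 3 / 4 * a * (b - a).
  by rewrite /e -mulrA mulrBl rD; lra.
have ae : a * e <= 3 / 10 * (b ^+ 2 - a ^+ 2) - 3 / 10 * (b - a) ^+ 2.
  rewrite -(ler_pM2r D0) -[leLHS]mulrA eD -subr_ge0.
  have -> : (3 / 10 * (b ^+ 2 - a ^+ 2) - 3 / 10 * (b - a) ^+ 2) * (a + b / 4)
    - a * (3 / 4 * a * (b - a)) = 3 / 20 * (a * (b - a) ^+ 2) by lra.
  by apply: mulr_ge0; [lra|apply: mulr_ge0 => //; exact: sqr_ge0].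
have e2 : e ^+ 2 <= 9 / 16 * (b - a) ^+ 2.
  have D20 : 0 < (a + b / 4) ^+ 2 by exact: exprn_gt0.
  have aD : a ^+ 2 <= (a + b / 4) ^+ 2 by rewrite ler_sqr ?nnegrE; lra.
  have h := ler_wpM2l (sqr_ge0 (b - a)) aD.
  rewrite -(ler_pM2r D20) -exprMn eD; lra.
have c1 : (c - a) ^+ 2 * r <= 4 * (c - a) ^+ 2.
  by rewrite mulrC; apply: ler_wpM2r => //; exact: sqr_ge0.
(* The weight 5 leaves [e^2 / 5], at most 9/80 of [(b - a)^2]. This gives the constants of the
   statement: -3/10 + 9/80 = -3/16, and 4 - 1 + 5 = 8. *)
have c2 : 2 * ((c - a) * e) <= 5 * (c - a) ^+ 2 + e ^+ 2 / 5.
  have := sqr_ge0 (5 * (c - a) - e); lra.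
have -> : c ^+ 2 * r = a ^+ 2 + a * e + (c - a) ^+ 2 * r
    + (c ^+ 2 - a ^+ 2 - (c - a) ^+ 2) + 2 * ((c - a) * e).
  by rewrite /e; ring.
by lra.
Qed.

Lemma ler_ln_sub1 a : 0 < a -> ln a <= a - 1.
Proof.
move=> a0; have := @le_ln1Dx R (a - 1).
by rewrite addrCA subrr addr0; apply; lra.
Qed.

Lemma le_kl_term p q : 0 <= p -> 0 <= q -> (0 < p -> 0 < q) ->
  p - q <= p * ln (p / q).
Proof.
move=> p0 q0 pq; have [->|/eqP p1] := p =P 0; first by rewrite mul0r; lra.
have {}p0 : 0 < p by rewrite lt0r p1.
have {}q0 := pq p0.
have := ler_ln_sub1 (divr_gt0 q0 p0).
rewrite -invf_div lnV ?posrE ?divr_gt0 // invf_div => h.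
have -> : p - q = - (p * (q / p - 1)) by field; lra.
by rewrite lerNl -mulrN; apply: ler_wpM2l => //; exact: ltW.
Qed.

(** By homogeneity only [y = sqrt p / sqrt q] matters, with [ln (p / q) = 2 ln y]. The ratio bound
    [A] enters through its logarithm only, which is why domination up to a factor is affordable. *)
Lemma kl_term_le p q A : 0 <= p -> 0 <= q -> 1 <= A -> p <= A * q ->
  p * ln (p / q) <= p - q + (3 + ln A) * (Num.sqrt p - Num.sqrt q) ^+ 2.
Proof.
move=> p0 q0 A1 pA; have lA : 0 <= ln A by exact: ln_ge0.
have [->|/eqP p1] := p =P 0.
  rewrite mul0r sqrtr0 !sub0r sqrrN sqr_sqrtr //.
  by have : 0 <= ln A * q by [exact: mulr_ge0]; lra.
have {p1}pgt : 0 < p by rewrite lt0r p1.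
have qgt : 0 < q by rewrite -(@pmulr_rgt0 _ A); lra.
have a0 : 0 < Num.sqrt p by rewrite sqrtr_gt0.
have b0 : 0 < Num.sqrt q by rewrite sqrtr_gt0.
have pE : p = Num.sqrt p ^+ 2 by rewrite sqr_sqrtr.
have qE : q = Num.sqrt q ^+ 2 by rewrite sqr_sqrtr.
have L1 : ln (p / q) <= ln A.
  by rewrite ler_ln ?posrE ?divr_gt0 //; [rewrite ler_pdivrMr|lra].
pose y := Num.sqrt p / Num.sqrt q.
have y0 : 0 < y by exact: divr_gt0.
have aE : Num.sqrt p = y * Num.sqrt q by rewrite /y; field; lra.
have L2 : ln (p / q) = 2 * ln y.
  rewrite {1}pE {1}qE -expr_div_n -/y lnXn // mulr_natl //.
have L3 := ler_ln_sub1 y0.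
have E1 : p = Num.sqrt q ^+ 2 * y ^+ 2 by rewrite mulrC -exprMn -aE.
have -> : p * ln (p / q) = Num.sqrt q ^+ 2 * (y ^+ 2 * ln (p / q)).
  by rewrite {1}E1 mulrA.
have -> : Num.sqrt p - Num.sqrt q = Num.sqrt q * (y - 1) by rewrite aE; ring.
have -> : p - q + (3 + ln A) * (Num.sqrt q * (y - 1)) ^+ 2 =
    Num.sqrt q ^+ 2 * (y ^+ 2 - 1 + (3 + ln A) * (y - 1) ^+ 2).
  by rewrite exprMn; lra.
apply: ler_wpM2l; first exact: sqr_ge0.
have s0 : 0 <= (y - 1) ^+ 2 by exact: sqr_ge0.
have [y1|y1] := leP y 1.
  have h1 : y ^+ 2 * ln (p / q) <= y ^+ 2 * (2 * (y - 1)).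
    by apply: ler_wpM2l; [exact: sqr_ge0|rewrite L2; lra].
  have h2 : 0 <= ln A * (y - 1) ^+ 2 by exact: mulr_ge0.
  have h3 : 0 <= (1 - y) * (y - 1) ^+ 2 by apply: mulr_ge0 => //; lra.
  by nra.
(* Split [y^2 = (y - 1)^2 + (2 y - 1)]: the first part uses the bound [ln A], the second the tangent
   bound. The constant 3 comes from the identity [2 (2 y - 1) (y - 1) = y^2 - 1 + 3 (y - 1)^2]. *)
have h1 : ln (p / q) * (y - 1) ^+ 2 <= ln A * (y - 1) ^+ 2.
  by apply: ler_wpM2r.
have h2 : (2 * y - 1) * ln (p / q) <= (2 * y - 1) * (2 * (y - 1)).
  by apply: ler_wpM2l; [lra|rewrite L2; lra].
by nra.
Qed.

(** Concavity of the square root: once the square is expanded, the mixture enters linearly except in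
    [- 2 sqrt p sqrt m], with [m] the mixture. *)
Lemma sqr_sqrt_mix_le p q (t : R) : 0 <= p -> 0 <= q -> 0 <= t <= 1 ->
  (Num.sqrt p - Num.sqrt ((1 - t) * p + t * q)) ^+ 2
    <= t * (Num.sqrt p - Num.sqrt q) ^+ 2.
Proof.
move=> p0 q0 /andP[t0 t1].
have m0 : 0 <= (1 - t) * p + t * q.
  by apply: addr_ge0; apply: mulr_ge0 => //; lra.
have := sqr_sqrtr m0; have := sqr_sqrtr p0; have := sqr_sqrtr q0.
have := sqrtr_ge0 ((1 - t) * p + t * q); have := sqrtr_ge0 p; have := sqrtr_ge0 q.
move: (Num.sqrt (_ + _)) (Num.sqrt p) (Num.sqrt q) => e a b b0 a0 e0 qE pE eE.
have s0 : 0 <= (1 - t) * a + t * b.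
  by apply: addr_ge0; apply: mulr_ge0 => //; lra.
have se : ((1 - t) * a + t * b) ^+ 2 <= e ^+ 2.
  rewrite eE -pE -qE -subr_ge0.
  have -> : (1 - t) * a ^+ 2 + t * b ^+ 2 - ((1 - t) * a + t * b) ^+ 2
    = t * (1 - t) * (a - b) ^+ 2 by ring.
  by apply: mulr_ge0; [apply: mulr_ge0; lra|exact: sqr_ge0].
have {}se : (1 - t) * a + t * b <= e by rewrite ler_sqr ?nnegrE in se.
rewrite -subr_ge0.
have -> : t * (a - b) ^+ 2 - (a - e) ^+ 2 =
    2 * (a * (e - ((1 - t) * a + t * b))) + ((1 - t) * p + t * q - e ^+ 2).
  by rewrite -pE -qE; ring.
by rewrite eE subrr addr0 mulr_ge0 // mulr_ge0 // subr_ge0.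
Qed.

End RealInequalities.

(** * Hellinger distance and Kullback-Leibler divergence of densities *)

Section Measurability.
Context {d} {T : measurableType d} {R : realType}.
Implicit Types f g : T -> R.

(** The factor [f x] restores the sign lost in [f x ^+ 2] and gives the conventional value 0 of the
    inverse at 0. *)
Lemma measurable_funV f :
  measurable_fun [set: T] f -> measurable_fun [set: T] (fun x => (f x)^-1).
Proof.
move=> mf.
have -> : (fun x => (f x)^-1) = (fun x => f x * (f x ^+ 2) `^ (-1)).
  apply/funext => x; rewrite powR_inv1 ?sqr_ge0 // expr2.
  have [->|/eqP f0] := f x =P 0; first by rewrite mul0r invr0.
  by rewrite invfM mulrA mulfV // mul1r.
apply: measurable_funM => //.
apply: (measurableT_comp (measurable_powR _)).
exact: measurable_funX.
Qed.

Lemma measurable_fun_div f g : measurable_fun [set: T] f ->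
  measurable_fun [set: T] g -> measurable_fun [set: T] (fun x => f x / g x).
Proof. by move=> mf mg; apply: measurable_funM => //; exact: measurable_funV. Qed.

Lemma measurable_fun_sqrt f :
  measurable_fun [set: T] f -> measurable_fun [set: T] (fun x => Num.sqrt (f x)).
Proof.
have ms : measurable_fun [set: R] (@Num.sqrt R).
  by apply: continuous_measurable_fun; exact: sqrt_continuous.
exact: measurableT_comp ms.
Qed.

Lemma measurable_fun_ln f :
  measurable_fun [set: T] f -> measurable_fun [set: T] (fun x => ln (f x)).
Proof. exact: measurableT_comp. Qed.

Lemma measurable_test_ratio f g : measurable_fun [set: T] f ->
  measurable_fun [set: T] g ->
  measurable_fun [set: T] (fun x => test_ratio (f x) (g x)).
Proof.
move=> mf mg; apply: measurable_fun_ifT => //.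
  by apply: measurable_fun_eqr => //; exact: measurable_funD.
by apply: measurable_fun_div; apply: measurable_funD => //;
  exact: measurable_funM.
Qed.

End Measurability.

Section Hellinger.
Context {d} {T : measurableType d} {R : realType}
  (mu : {measure set T -> \bar R}).
Implicit Types (p q s : T -> R) (f g : T -> R).

Local Notation intble f := (mu.-integrable [set: T] (EFin \o f)).
Local Notation h2 := (hellinger_sq mu).

Lemma dens_measurable p : is_density mu p -> measurable_fun [set: T] p.
Proof. by case. Qed.

Lemma dens_ge0 p : is_density mu p -> forall x, 0 <= p x.
Proof. by case. Qed.

Lemma dens_integrable p : is_density mu p -> intble p.
Proof.
case=> mp p0 p1; apply/integrableP; split; first exact/measurable_EFinP.
under eq_integral do rewrite /= ger0_norm //.
by rewrite p1 ltry.
Qed.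

Lemma dens_Rintegral p : is_density mu p -> \int[mu]_x p x = 1.
Proof. by case=> _ _ p1; rewrite /Rintegral p1. Qed.

Lemma intbleD f g : intble f -> intble g -> intble (fun x => f x + g x).
Proof. by move=> i j; have := integrableD measurableT i j. Qed.

Lemma intbleB f g : intble f -> intble g -> intble (fun x => f x - g x).
Proof. by move=> i j; have := integrableB measurableT i j. Qed.

Lemma intbleZ f (c : R) : intble f -> intble (fun x => c * f x).
Proof. by move=> i; have := integrableZl measurableT c i. Qed.

Lemma intble_le f g : measurable_fun [set: T] f ->
  (forall x, `|f x| <= g x) -> intble g -> intble f.
Proof.
move=> mf fg; apply: le_integrable => //; first exact/measurable_EFinP.
move=> x _ /=; rewrite lee_fin (le_trans (fg x)) //; exact: ler_norm.
Qed.

Lemma le_RintegralT f g : intble f -> intble g -> (forall x, f x <= g x) ->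
  \int[mu]_x f x <= \int[mu]_x g x.
Proof. by move=> i j fg; apply: le_Rintegral. Qed.

Lemma intble_sqr_sub p q : is_density mu p -> is_density mu q ->
  intble (fun x => (Num.sqrt (p x) - Num.sqrt (q x)) ^+ 2).
Proof.
move=> dp dq; apply: (@intble_le _ (fun x => p x + q x)).
- apply: measurable_funX; apply: measurable_funB; apply: measurable_fun_sqrt;
    exact: dens_measurable.
- move=> x; rewrite ger0_norm ?sqr_ge0 //.
  have p0 := dens_ge0 dp x; have q0 := dens_ge0 dq x.
  rewrite sqrrB !sqr_sqrtr //.
  have : 0 <= Num.sqrt (p x) * Num.sqrt (q x) by apply: mulr_ge0; exact: sqrtr_ge0.
  by rewrite -mulr_natl; lra.
- by apply: intbleD; exact: dens_integrable.
Qed.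

Lemma hsq_int p q : \int[mu]_x (Num.sqrt (p x) - Num.sqrt (q x)) ^+ 2 = 2 * h2 p q.
Proof. by rewrite /hellinger_sq mulrA divff ?mul1r. Qed.

Lemma hsq_ge0 p q : 0 <= h2 p q.
Proof.
apply: mulr_ge0 => //; apply: Rintegral_ge0 => x _; exact: sqr_ge0.
Qed.

Lemma hsqC p q : h2 p q = h2 q p.
Proof.
congr (_ * _); apply: eq_Rintegral => x _.
by rewrite -sqrrN opprB.
Qed.

Lemma hsqxx p : h2 p p = 0.
Proof.
rewrite /hellinger_sq; under eq_Rintegral do rewrite subrr expr0n /=.
by rewrite /Rintegral integral0 mulr0.
Qed.

Lemma hsq_le1 p q : is_density mu p -> is_density mu q -> h2 p q <= 1.
Proof.
move=> dp dq.
suff : 2 * h2 p q <= 2 by lra.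
rewrite -hsq_int; apply: (@le_trans _ _ (\int[mu]_x (p x + q x))).
  apply: le_RintegralT; [exact: intble_sqr_sub|apply: intbleD; exact: dens_integrable|].
  move=> x; have p0 := dens_ge0 dp x; have q0 := dens_ge0 dq x.
  rewrite sqrrB !sqr_sqrtr //.
  have : 0 <= Num.sqrt (p x) * Num.sqrt (q x) by apply: mulr_ge0; exact: sqrtr_ge0.
  by rewrite -mulr_natl; lra.
by rewrite RintegralD ?dens_Rintegral //; apply: dens_integrable.
Qed.

Lemma hsq_quasi_triangle p q s : is_density mu p -> is_density mu q ->
  is_density mu s -> h2 p s <= 2 * h2 p q + 2 * h2 q s.
Proof.
move=> dp dq ds; suff : 2 * h2 p s <= 2 * (2 * h2 p q) + 2 * (2 * h2 q s) by lra.
rewrite -!hsq_int -!RintegralZl // -?RintegralD //;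
  do ?[exact: intble_sqr_sub|apply: intbleZ; exact: intble_sqr_sub].
apply: le_RintegralT.
- exact: intble_sqr_sub.
- by apply: intbleD; apply: intbleZ; exact: intble_sqr_sub.
move=> x; move: (Num.sqrt (p x)) (Num.sqrt (q x)) (Num.sqrt (s x)) => a b c.
have := sqr_ge0 (a - b - (b - c)); lra.
Qed.

Lemma hellinger_le p q (r : R) : 0 <= r ->
  (hellinger mu p q <= r) = (h2 p q <= r ^+ 2).
Proof.
move=> r0; by rewrite /hellinger -{1}(ger0_norm r0) -sqrtr_sqr ler_sqrt // sqr_ge0.
Qed.

Lemma hsq_mix p q (t : R) : is_density mu p -> is_density mu q ->
  is_density mu (fun x => (1 - t) * p x + t * q x) -> 0 <= t <= 1 ->
  h2 p (fun x => (1 - t) * p x + t * q x) <= t * h2 p q.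
Proof.
move=> dp dq dm /andP[t0 t1].
suff : 2 * h2 p (fun x => (1 - t) * p x + t * q x) <= t * (2 * h2 p q) by lra.
rewrite -!hsq_int -RintegralZl //; last exact: intble_sqr_sub.
apply: le_RintegralT; [exact: intble_sqr_sub|apply: intbleZ; exact: intble_sqr_sub|].
by move=> x; apply: sqr_sqrt_mix_le; rewrite ?t0 //; exact: dens_ge0.
Qed.

Lemma intble_test p q s : is_density mu p -> is_density mu q ->
  is_density mu s ->
  intble (fun x => s x * test_ratio (Num.sqrt (p x)) (Num.sqrt (q x))).
Proof.
move=> dp dq ds; apply: (@intble_le _ (fun x => 4 * s x)).
- apply: measurable_funM; first exact: dens_measurable.
  by apply: measurable_test_ratio; apply: measurable_fun_sqrt; exact: dens_measurable.
- move=> x; have a0 := sqrtr_ge0 (p x); have b0 := sqrtr_ge0 (q x).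
  rewrite ger0_norm; last by rewrite mulr_ge0 ?(dens_ge0 ds) // ltW ?test_ratio_gt0.
  rewrite mulrC; apply: ler_wpM2r; first exact: dens_ge0.
  rewrite /test_ratio; case: eqP => [_|/eqP ab]; first lra.
  by rewrite ler_pdivrMr; lra.
- by apply: intbleZ; exact: dens_integrable.
Qed.

(* The expectation under [s] of the robust likelihood ratio between [p] and
   [q] drops below 1 as soon as [s] is close to [p] at the scale of [h2 p q]. *)
Lemma test_expectation p q s : is_density mu p -> is_density mu q ->
  is_density mu s ->
  \int[mu]_x (s x * test_ratio (Num.sqrt (p x)) (Num.sqrt (q x)))
    <= 1 - 3 / 8 * h2 p q + 16 * h2 s p.
Proof.
move=> dp dq ds.
pose g x := (s x + 3 / 10 * (q x - p x)) +
  ((- (3 / 16)) * (Num.sqrt (p x) - Num.sqrt (q x)) ^+ 2 +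
  8 * (Num.sqrt (s x) - Num.sqrt (p x)) ^+ 2).
have ip := dens_integrable dp; have iq := dens_integrable dq.
have is_ := dens_integrable ds.
have i1 := intble_sqr_sub dp dq; have i2 := intble_sqr_sub ds dp.
have j1 := intbleB iq ip.
have j2 := intbleZ (3 / 10) j1.
have j3 := intbleD is_ j2.
have j4 := intbleZ (- (3 / 16)) i1.
have j5 := intbleZ 8 i2.
have j6 := intbleD j4 j5.
have -> : 1 - 3 / 8 * h2 p q + 16 * h2 s p = \int[mu]_x g x.
  rewrite /g RintegralD // RintegralD // RintegralD // !RintegralZl //.
  rewrite RintegralB // !hsq_int !dens_Rintegral //; lra.
apply: le_RintegralT; [exact: intble_test|exact: intbleD|].
move=> x; rewrite /g.
have := @test_ratio_le R _ _ (Num.sqrt (s x)) (sqrtr_ge0 (p x)) (sqrtr_ge0 (q x)).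
rewrite !sqr_sqrtr ?dens_ge0 // => h.
rewrite (le_trans h) //.
have -> : (Num.sqrt (q x) - Num.sqrt (p x)) ^+ 2 = (Num.sqrt (p x) - Num.sqrt (q x)) ^+ 2.
  by rewrite -sqrrN opprB.
by lra.
Qed.

(** [le_kl_term] controls the negative part of the integrand and [kl_term_le] the positive part. *)
Lemma intble_kl p q (A : R) : is_density mu p -> is_density mu q -> 1 <= A ->
  (forall x, p x <= A * q x) -> intble (fun x => p x * ln (p x / q x)).
Proof.
move=> dp dq A1 pq.
have lA : 0 <= ln A by exact: ln_ge0.
apply: (@intble_le _ (fun x => (p x + q x) +
   (3 + ln A) * (Num.sqrt (p x) - Num.sqrt (q x)) ^+ 2)).
- have mp := dens_measurable dp; have mq := dens_measurable dq.
  apply: measurable_funM => //; apply: measurable_fun_ln.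
  exact: measurable_fun_div.
- move=> x; have p0 := dens_ge0 dp x; have q0 := dens_ge0 dq x.
  have pq0 : 0 < p x -> 0 < q x.
    move=> px; have := pq x; have [->|/eqP q1 _] := q x =P 0; last by rewrite lt0r q1.
    by rewrite mulr0; lra.
  have := le_kl_term p0 q0 pq0; have := kl_term_le p0 q0 A1 (pq x).
  have : 0 <= (3 + ln A) * (Num.sqrt (p x) - Num.sqrt (q x)) ^+ 2.
    by apply: mulr_ge0; [lra|exact: sqr_ge0].
  by rewrite ler_norml; lra.
- apply: intbleD; first by apply: intbleD; exact: dens_integrable.
  by apply: intbleZ; exact: intble_sqr_sub.
Qed.

Lemma kl_le_hsq p q (A : R) : is_density mu p -> is_density mu q -> 1 <= A ->
  (forall x, p x <= A * q x) ->
  \int[mu]_x (p x * ln (p x / q x)) <= 2 * (3 + ln A) * h2 p q.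
Proof.
move=> dp dq A1 pq; have ikl := intble_kl dp dq A1 pq.
have ip := dens_integrable dp; have iq := dens_integrable dq.
have i1 := intble_sqr_sub dp dq.
have j1 := intbleB ip iq.
have j2 := intbleZ (3 + ln A) i1.
have -> : 2 * (3 + ln A) * h2 p q = \int[mu]_x ((p x - q x) +
   (3 + ln A) * (Num.sqrt (p x) - Num.sqrt (q x)) ^+ 2).
  by rewrite RintegralD // RintegralB // RintegralZl // hsq_int !dens_Rintegral //; lra.
apply: le_RintegralT => //; first exact: intbleD.
by move=> x; apply: kl_term_le => //; exact: dens_ge0.
Qed.

Lemma kl_ge0 p q (A : R) : is_density mu p -> is_density mu q -> 1 <= A ->
  (forall x, p x <= A * q x) -> 0 <= \int[mu]_x (p x * ln (p x / q x)).
Proof.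
move=> dp dq A1 pq; have ikl := intble_kl dp dq A1 pq.
have ip := dens_integrable dp; have iq := dens_integrable dq.
have -> : 0 = \int[mu]_x (p x - q x).
  by rewrite RintegralB // !dens_Rintegral // subrr.
apply: le_RintegralT => //; first exact: intbleB.
move=> x; apply: le_kl_term; do ?exact: dens_ge0.
move=> px; have := pq x; have q0 := dens_ge0 dq x.
have [->|/eqP q1 _] := q x =P 0; last by rewrite lt0r q1.
by rewrite mulr0; lra.
Qed.

(** Domination forces [p] to vanish wherever [q] does, so the [+oo] branch of [KL] is never
    taken. *)
Lemma KLE p q (A : R) : is_density mu p -> is_density mu q -> 1 <= A ->
  (forall x, p x <= A * q x) ->
  KL mu p q = (\int[mu]_x (p x * ln (p x / q x)))%:E.
Proof.
move=> dp dq A1 pq.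
rewrite /Rintegral fineK; last first.
  exact: integrable_fin_num (intble_kl dp dq A1 pq).
apply: eq_integral => x _.
have [->|/eqP p0] := p x =P 0; first by rewrite mul0r.
case: eqP => // q0; exfalso; have := pq x; have := dens_ge0 dp x.
by rewrite q0 mulr0; move/eqP in p0; lra.
Qed.

End Hellinger.

(** * Integrating out an independent coordinate *)

Section ChangeOfDensity.
Context {d} {T : measurableType d} {R : realType}
  (mu nu : {measure set T -> \bar R}) (p : T -> R).
Hypothesis mp : measurable_fun [set: T] p.
Hypothesis p0 : forall x, 0 <= p x.
Hypothesis nuE : forall A, measurable A -> (nu A = \int[mu]_(x in A) (p x)%:E)%E.

Local Open Scope ereal_scope.
Import HBNNSimple.

Let mpE : measurable_fun [set: T] (fun x => (p x)%:E).
Proof. exact/measurable_EFinP. Qed.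

Let integral_dens_nnsfun (h : {nnsfun T >-> R}) :
  \int[nu]_x (h x)%:E = \int[mu]_x ((h x)%:E * (p x)%:E).
Proof.
have mi r : measurable (h @^-1` [set r]) by exact: measurable_funPTI.
transitivity (\int[nu]_x \sum_(y \in range h) (y * \1_(h @^-1` [set y]) x)%:E).
  by apply: eq_integral => t _; rewrite /= fimfunE -fsumEFin.
transitivity (\int[mu]_x \sum_(y \in range h)
    ((y * \1_(h @^-1` [set y]) x)%:E * (p x)%:E)); last first.
  apply: eq_integral => t _.
  rewrite -ge0_mule_fsuml; last by move=> y; exact: nnfun_muleindic_ge0.
  by rewrite fsumEFin // -fimfunE.
have mii y : measurable_fun [set: T] (fun x => (y * \1_(h @^-1` [set y]) x)%:E).
  by apply/measurable_EFinP; exact: measurable_funM.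
rewrite ge0_integral_fsum //; last by move=> y x _; exact: nnfun_muleindic_ge0.
rewrite ge0_integral_fsum //; last 2 first.
- by move=> y; exact: emeasurable_funM.
- by move=> y x _; apply: mule_ge0; [exact: nnfun_muleindic_ge0|rewrite lee_fin].
apply: eq_fsbigr => r rhn.
have r0 : (0 <= r)%R by move: rhn; rewrite inE => -[t _ <-].
under eq_integral do rewrite EFinM.
under [RHS]eq_integral do rewrite EFinM -muleA.
have m1 : measurable_fun [set: T] (fun x => (\1_(h @^-1` [set r]) x)%:E : \bar R).
  exact/measurable_EFinP.
rewrite ge0_integralZl //.
rewrite ge0_integralZl //; last 2 first.
- exact: emeasurable_funM.
- by move=> x _; rewrite mule_ge0 // lee_fin.
congr (_ * _); rewrite integral_indic // setIT nuE // integral_mkcond.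
by apply: eq_integral => x _; rewrite epatch_indic muleC.
Qed.

(** The identity holds for simple functions and passes to the limit by monotone convergence on both
    sides. *)
Lemma ge0_integral_density (f : T -> \bar R) : measurable_fun [set: T] f ->
  (forall x, 0 <= f x) -> \int[nu]_x f x = \int[mu]_x (f x * (p x)%:E).
Proof.
move=> mf f0; pose h := nnsfun_approx measurableT mf.
have hf x : (EFin \o h n) x @[n --> \oo] --> f x by exact: cvg_nnsfun_approx.
have -> : \int[nu]_x f x = lim (\int[nu]_x (EFin \o h n) x @[n --> \oo]).
  under eq_integral => x _ do rewrite -(cvg_lim (@ereal_hausdorff R) (hf x)).
  apply: monotone_convergence => //.
  - by move=> n; apply/measurable_EFinP.
  - by move=> n x _ /=; rewrite lee_fin.
  - by move=> x _ a b ab; rewrite lee_fin; exact/lefP/nd_nnsfun_approx.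
have -> : \int[mu]_x (f x * (p x)%:E) =
    lim (\int[mu]_x ((EFin \o h n) x * (p x)%:E) @[n --> \oo]).
  have hfp x : ((EFin \o h n) x * (p x)%:E) @[n --> \oo] --> f x * (p x)%:E.
    by apply: cvgeZr.
  under eq_integral => x _ do rewrite -(cvg_lim (@ereal_hausdorff R) (hfp x)).
  apply: monotone_convergence => //.
  - by move=> n; apply: emeasurable_funM => //; apply/measurable_EFinP.
  - by move=> n x _ /=; rewrite mule_ge0 ?lee_fin.
  - move=> x _ a b ab /=; rewrite lee_wpmul2r ?lee_fin //.
    exact/lefP/nd_nnsfun_approx.
by under eq_fun do rewrite integral_dens_nnsfun.
Qed.

End ChangeOfDensity.

Section Independence.
Context {d d1 d2} {Omega : measurableType d} {S : measurableType d1}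
  {T : measurableType d2} {R : realType} (Q : probability Omega R).
Variables (W : {RV Q >-> S}) (Y : {RV Q >-> T}).

(** Independence identifies the joint law with the product law, by uniqueness on rectangles; both
    factors are probabilities, so Tonelli applies. *)
Lemma integral_indep_pair (f : S * T -> \bar R) :
  (forall A B, measurable A -> measurable B ->
    Q (W @^-1` A `&` Y @^-1` B) = Q (W @^-1` A) * Q (Y @^-1` B))%E ->
  measurable_fun [set: S * T] f -> (forall z, (0 <= f z)%E) ->
  measurable_fun [set: Omega] (fun w => \int[distribution Q Y]_y f (W w, y))%E /\
  (\int[Q]_w f (W w, Y w) =
  \int[Q]_w \int[distribution Q Y]_y f (W w, y))%E.
Proof.
move=> ind mf f0.
have mF := @measurable_fun_fubini_tonelli_F _ _ S T R (distribution Q Y) f mf f0.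
have mW : measurable_fun [set: Omega] W by [].
split; first exact: (measurableT_comp mF mW).
pose Z w := (W w, Y w).
have mZ : measurable_fun [set: Omega] Z by exact: measurable_fun_pair.
pose ZP : {RV Q >-> (S * T)%type} := HB.pack Z (isMeasurableFun.Build _ _ _ _ Z mZ).
transitivity (\int[distribution Q ZP]_z f z)%E.
  by rewrite ge0_integral_distribution.
transitivity (\int[distribution Q W \x distribution Q Y]_z f z)%E.
  apply: eq_measure_integral => A mA _.
  by apply/esym; apply: product_measure_unique.
rewrite fubini_tonelli1 //.
by rewrite ge0_integral_distribution // => y; exact: integral_ge0.
Qed.

End Independence.

Section Prefix.
Context {d d'} {Omega : measurableType d'} {T : measurableType d}
  {R : realType} (Q : probability Omega R) (n : nat).
Variables (X : 'I_n -> {RV Q >-> T}) (x0 : T).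
Hypothesis indX : mutually_independent X.

Let tX w : n.-tuple T := [tuple X i w | i < n].

(* [x0] overwrites the coordinates from [k] on, so that functions of the first
   [k] coordinates factor through a map into the fixed type of [n]-tuples. *)
Definition mask (k : nat) (s : n.-tuple T) : n.-tuple T :=
  [tuple if (i < k)%N then tnth s i else x0 | i < n].

Lemma measurable_sample : measurable_fun [set: Omega] tX.
Proof.
apply/measurable_fun_tnthP => i.
rewrite (_ : _ \o _ = X i) //.
by apply/funext => w /=; rewrite tnth_mktuple.
Qed.

Lemma measurable_mask k : measurable_fun [set: Omega] (mask k \o tX).
Proof.
apply/measurable_fun_tnthP => i; case: (ltnP i k) => ik.
  rewrite (_ : _ \o _ = X i) //.
  by apply/funext => w /=; rewrite !tnth_mktuple ik.
rewrite (_ : _ \o _ = cst x0) //.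
by apply/funext => w /=; rewrite !tnth_mktuple ltnNge ik.
Qed.

Definition tuple_box (F : 'I_n -> set T) : set (n.-tuple T) :=
  [set s | forall i, F i (tnth s i)].

Lemma measurable_tuple_box F : (forall i, measurable (F i)) ->
  measurable (tuple_box F).
Proof.
move=> mF; rewrite (_ : tuple_box F = \bigcap_(i in [set: 'I_n])
    ((fun s => tnth s i) @^-1` F i)); last first.
  by apply/seteqP; split=> [s h i _|s h i]; exact: h.
apply: fin_bigcap_measurable; first exact: finite_finset.
move=> i _; rewrite -[X in measurable X]setTI.
exact: measurable_tnth.
Qed.

Let boxes := [set A | exists2 F, forall i, measurable (F i) & A = tuple_box F].

Lemma measurable_tuple_gen :
  measurable = <<s boxes >> :> set (set (n.-tuple T)).
Proof.
apply/seteqP; split; last first.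
  apply: smallest_sub; first exact: sigma_algebra_measurable.
  by move=> _ [F mF ->]; exact: measurable_tuple_box.
apply: smallest_sub; first exact: smallest_sigma_algebra.
rewrite -bigcup_seq => A [i _] [B mB <-]; apply: sub_sigma_algebra.
exists (fun j => if j == i then B else setT); first by move=> j; case: ifP.
apply/seteqP; split => [s [_ h] j|s /(_ i)]; last by rewrite eqxx.
by case: eqP => // ->.
Qed.

Let indep_box (k : 'I_n) F B : (forall i, measurable (F i)) -> measurable B ->
  (Q ((mask k \o tX) @^-1` tuple_box F `&` X k @^-1` B) =
   Q ((mask k \o tX) @^-1` tuple_box F) * Q (X k @^-1` B))%E.
Proof.
move=> mF mB.
(* Masked coordinates are constantly [x0]: if some side [F i] with [k <= i] misses [x0] the event is
   empty, otherwise these sides impose nothing. *)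
have [ex|nex] := pselect (forall i : 'I_n, (k <= i)%N -> F i x0); last first.
  have -> : (mask k \o tX) @^-1` tuple_box F = set0.
    apply/seteqP; split => // w h; apply: nex => i ki.
    by have := h i; rewrite /= !tnth_mktuple ltnNge ki.
  by rewrite set0I measure0 mul0e.
pose J : {set 'I_n} := [set i : 'I_n | (i < k)%N]%SET.
pose A i := if i == k then B else F i.
have mA i : measurable (A i) by rewrite /A; case: ifP.
have AF i : i \in J -> A i = F i.
  by rewrite inE /A; case: eqP => // ->; rewrite ltnn.
have E1 : (mask k \o tX) @^-1` tuple_box F =
    \bigcap_(i in [set` J]) X i @^-1` A i.
  apply/seteqP; split => [w h i /= iJ|w h i].
    have := h i; rewrite AF // /= !tnth_mktuple.
    by move: iJ; rewrite inE => ->.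
  rewrite /= !tnth_mktuple; case: ltnP => ik; last exact: ex.
  have iJ : i \in J by rewrite inE.
  by rewrite -AF //; exact: h.
have E2 : (mask k \o tX) @^-1` tuple_box F `&` X k @^-1` B =
    \bigcap_(i in [set` (k |: J)%SET]) X i @^-1` A i.
  rewrite E1; apply/seteqP; split => [w [h hB] i /=|w h].
    by rewrite !inE => /orP[/eqP ->|ik]; [rewrite /A eqxx|apply: h; rewrite /= inE].
  split => [i iJ|]; first by apply: h; rewrite /= !inE; move: iJ; rewrite /= inE => ->; rewrite orbT.
  by have := h k; rewrite /= !inE eqxx /A eqxx; apply.
rewrite E2 (indX _ mA) big_setU1 /= ?inE ?ltnn // -(indX _ mA) E1 /A eqxx.
by rewrite muleC.
Qed.

(** Mutual independence gives the product formula on boxes only. Both sides are finite measures in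
    [A], and boxes are closed under intersection and generate the sigma-algebra. *)
Lemma indep_mask (k : 'I_n) A B : measurable A -> measurable B ->
  (Q ((mask k \o tX) @^-1` A `&` X k @^-1` B) =
   Q ((mask k \o tX) @^-1` A) * Q (X k @^-1` B))%E.
Proof.
move=> mA mB.
pose W : {RV Q >-> (n.-tuple T)} :=
  HB.pack (mask k \o tX) (isMeasurableFun.Build _ _ _ _ _ (measurable_mask k)).
have mXB : measurable (X k @^-1` B) by exact: measurable_funPTI.
have fQ : Q (X k @^-1` B) \is a fin_num by exact: fin_num_measure.
have Q0 : 0 <= fine (Q (X k @^-1` B)) by exact: fine_ge0.
have mW : measurable_fun [set: Omega] W by [].
pose m1' : {measure set (n.-tuple T) -> \bar R} := pushforward (mrestr Q mXB) W.
pose m1 := m1' mW.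
pose m2 : {measure set (n.-tuple T) -> \bar R} :=
  mscale (NngNum Q0) (distribution Q W).
have m1E C : m1 C = Q (W @^-1` C `&` X k @^-1` B) by [].
have m2E C : m2 C = (Q (W @^-1` C) * Q (X k @^-1` B))%E.
  by rewrite /m2 /= /mscale /= fineK // muleC.
suff : m1 A = m2 A by rewrite m1E m2E.
apply: (@measure_unique _ _ _ boxes (fun=> setT)) => //.
- exact: measurable_tuple_gen.
- move=> _ _ [F mF ->] [G mG ->]; exists (fun i => F i `&` G i).
    by move=> i; exact: measurableI.
  apply/seteqP; split=> [s [f g] i|s h]; first by split.
  by split=> i; have [] := h i.
- by move=> _; exists (fun=> setT) => //; apply/seteqP; split.
- by rewrite bigcup_const.
- by move=> _ [F mF ->]; rewrite m1E m2E indep_box.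
- by move=> _; rewrite m1E preimage_setT setTI ltey_eq fQ.
Qed.

Variables (mu : {measure set T -> \bar R}) (p : T -> R).
Hypothesis mp : measurable_fun [set: T] p.
Hypothesis p0 : forall x, 0 <= p x.
Hypothesis Xp : forall i A, measurable A ->
  (distribution Q (X i) A = \int[mu]_(x in A) (p x)%:E)%E.

(** This replaces conditioning on the first [k] observations: masking does not change a function of
    them, and the masked sample is independent of [X k]. Measurability of the inner integral is
    obtained on the way, from Tonelli for the law of [X k]. *)
Lemma integral_fresh_coord (k : 'I_n) (f : n.-tuple T * T -> \bar R) :
  measurable_fun [set: n.-tuple T * T] f -> (forall z, (0 <= f z)%E) ->
  (forall s s' y, (forall i : 'I_n, (i < k)%N -> tnth s i = tnth s' i) ->
    f (s, y) = f (s', y)) ->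
  measurable_fun [set: Omega] (fun w => \int[mu]_y (f (tX w, y) * (p y)%:E))%E /\
  (\int[Q]_w f (tX w, X k w) =
   \int[Q]_w \int[mu]_y (f (tX w, y) * (p y)%:E))%E.
Proof.
move=> mf f0 fk.
pose W : {RV Q >-> (n.-tuple T)} :=
  HB.pack (mask k \o tX) (isMeasurableFun.Build _ _ _ _ _ (measurable_mask k)).
have fW w y : f (W w, y) = f (tX w, y).
  by apply: fk => i ik; rewrite /= tnth_mktuple ik.
have [mF EF] := @integral_indep_pair _ _ _ _ _ _ _ Q W (X k) f
  (@indep_mask k) mf f0.
have E w : (\int[distribution Q (X k)]_y f (W w, y) =
    \int[mu]_y (f (tX w, y) * (p y)%:E))%E.
  rewrite (ge0_integral_density mp p0 (Xp k)) //; last exact: measurableT_comp.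
  by apply: eq_integral => y _; rewrite fW.
split.
  by under eq_fun do rewrite -E.
under eq_integral do rewrite -fW.
by rewrite EF; apply: eq_integral => w _; rewrite E.
Qed.

End Prefix.

(** * Local entropy and separated families *)

(** Indexing by ['I_k], possibly with repetitions, gives access to finite sums. The surjection may
    take values outside [A]; these are replaced by [a0]. *)
Lemma enum_card_le (U : pointedType) (A : set U) (k : nat) :
  A #<= `I_k -> A !=set0 ->
  exists c : 'I_k -> U, (forall i, A (c i)) /\ forall a, A a -> exists i, c i = a.
Proof.
move=> /pcard_surjP[g sg] [a0 Aa0].
exists (fun i : 'I_k => if `[< A (g i) >] then g i else a0); split.
  by move=> i; case: asboolP.
move=> a Aa; have [i /= ik gi] := sg _ Aa; exists (Ordinal ik) => /=.
by rewrite gi; case: asboolP.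
Qed.

Section Net.
Context {d} {T : measurableType d} {R : realType}
  (mu : {measure set T -> \bar R}).
Variables (P : set (T -> R)) (eps V : R).
Hypothesis Pd : forall p, P p -> is_density mu p.
Hypothesis eps0 : 0 < eps.
Hypothesis PV : (local_entropy mu P eps <= V%:E)%E.

Local Notation h2 := (hellinger_sq mu).

Lemma local_cover p (eta : R) : P p -> eps <= eta ->
  exists k (c : 'I_k -> T -> R), [/\ k%:R <= V, forall i, P (c i) &
    forall f, P f -> h2 p f <= eta ^+ 2 ->
      exists i, h2 (c i) f <= eta ^+ 2 / 4].
Proof.
move=> Pp ee; have eta0 : 0 < eta := lt_le_trans eps0 ee.
set F := hellinger_ball mu p eta `&` P.
have : (covering_number mu F (eta / 2) <= V%:E)%E.
  apply: le_trans PV.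
  apply: (@le_trans _ _ (ereal_sup [set covering_number mu
      (hellinger_ball mu p e `&` P) (e / 2) | e in [set e : R | eps <= e]])).
    by apply: ereal_sup_ubound; exists eta.
  by apply: ereal_sup_ubound; exists p.
rewrite /covering_number; set K := [set k : nat | _].
(* Without a finite cover the infimum would be [+oo], above the real number [V]; hence a cover of
   least size exists. *)
have [[k0 Kk0]|K0] := pselect (K !=set0); last first.
  have -> : K = set0 by apply/eqP; apply: contrapT => /negP/set0P.
  by rewrite image_set0 ereal_inf0 leye_eq.
have exK : exists k, `[< K k >] by exists k0; exact/asboolP.
case: (ex_minnP exK) => k /asboolP Kk kmin.
move=> infV.
have kV : k%:R <= V.
  rewrite -lee_fin (le_trans _ infV) //.
  apply: le_ereal_inf_tmp => _ [l Kl <-]; rewrite lee_fin ler_nat.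
  by apply: kmin; exact/asboolP.
have Fp : F p.
  split => //; split; first exact: Pd.
  by rewrite hellinger_le ?hsqxx ?sqr_ge0 // ltW.
case: Kk => F0 [F0F cF0 cov].
have F0n : F0 !=set0 by have [g F0g _] := cov _ Fp; exists g.
have [c [cF0' c_surj]] : exists c : 'I_k -> T -> R, (forall i, F0 (c i)) /\
    forall a, F0 a -> exists i, c i = a.
  by apply: enum_card_le => //; move: cF0; rewrite card_eq_le => /andP[].
exists k, c; split => //; first by move=> i; have [] := F0F _ (cF0' i).
move=> f Pf pf.
have Ff : F f.
  split => //; split; first exact: Pd.
  by rewrite hellinger_le // ltW.
have [g F0g fg] := cov _ Ff; have [i ig] := c_surj _ F0g.
exists i; rewrite hsqC ig; move: fg; rewrite hellinger_le; last by lra.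
by rewrite expr_div_n; have -> : (2 : R) ^+ 2 = 4 by lra.
Qed.

(* The radius starts at [eps / 2], where a ball contains at most one point of
   the family; each doubling costs one application of the local cover. *)
Lemma separated_ball_card k (g : 'I_k -> T -> R) (j : nat) p :
  (forall i, P (g i)) ->
  (forall i i', i != i' -> eps ^+ 2 < h2 (g i) (g i')) -> P p ->
  #|[set i | h2 p (g i) <= 4 ^+ j * (eps ^+ 2 / 4)]%SET|%:R <= V ^+ j.
Proof.
move=> Pg sep; elim: j p => [|j IH] p Pp.
  rewrite !expr0 mul1r lern1 leqNgt; apply/negP => /card_gt1P[i [i' []]].
  (* Two members of this ball would be at squared distance at most 2 (eps^2 / 4) + 2 (eps^2 / 4) =
     eps^2, against strict separation. *)
  rewrite !inE => h h' /sep; apply/negP; rewrite -leNgt.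
  rewrite (le_trans (hsq_quasi_triangle (Pd (Pg i)) (Pd Pp) (Pd (Pg i')))) //.
  by rewrite (hsqC mu (g i)); lra.
have e2 : (2 ^+ j * eps) ^+ 2 / 4 = 4 ^+ j * (eps ^+ 2 / 4).
  by rewrite exprMn exprAC mulrA; have -> : (2 : R) ^+ 2 = 4 by lra.
have e2' : (2 ^+ j * eps) ^+ 2 = 4 ^+ j.+1 * (eps ^+ 2 / 4).
  have -> : (4 : R) ^+ j.+1 = 4 * 4 ^+ j by rewrite exprS.
  by rewrite -mulrA -e2; lra.
have ee : eps <= 2 ^+ j * eps.
  by rewrite ler_peMl ?exprn_ege1 //; [exact: ltW|lra].
have [l [c [lV Pc cov]]] := local_cover Pp ee.
set A := [set i | _]%SET.
have sub : A \subset (\bigcup_(t : 'I_l)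
    [set i | h2 (c t) (g i) <= 4 ^+ j * (eps ^+ 2 / 4)])%SET.
  apply/fintype.subsetP => i; rewrite inE -e2' => hi.
  have [t ht] := cov _ (Pg i) hi.
  by apply/finset.bigcupP; exists t => //; rewrite inE -e2.
apply: (@le_trans _ _ (\sum_(t < l) V ^+ j)); last first.
  rewrite big_const_ord iter_addr_0 -mulr_natl exprS ler_wpM2r //.
  by apply: (le_trans _ (IH p Pp)).
apply: (@le_trans _ _ (\sum_(t < l)
    #|[set i | h2 (c t) (g i) <= 4 ^+ j * (eps ^+ 2 / 4)]%SET|%:R)).
  rewrite -natr_sum ler_nat (leq_trans (subset_leq_card sub)) //.
  elim/big_rec2: _ => [|t m B _ h]; first by rewrite cards0.
  by rewrite (leq_trans (leq_card_setU _ _)) // leq_add2l.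
by apply: ler_sum => t _; exact: IH.
Qed.

(** Squared distances are at most 1, so a large enough ball contains any separated family and
    [separated_ball_card] caps its size. A family of maximal size is a net: a point far from all
    members could be added to it. *)
Lemma net_exists : P !=set0 -> exists k (g : 'I_k -> T -> R),
  [/\ forall i, P (g i),
     forall i i', i != i' -> eps ^+ 2 < h2 (g i) (g i') &
     forall p, P p -> exists i, h2 p (g i) <= eps ^+ 2].
Proof.
move=> [p0 Pp0].
pose B k := `[< exists g : 'I_k -> T -> R, (forall i, P (g i)) /\
  forall i i', i != i' -> eps ^+ 2 < h2 (g i) (g i') >].
have [j hj] : exists j, 1 <= 4 ^+ j * (eps ^+ 2 / 4).
  pose j := Num.bound ((eps ^+ 2 / 4)^-1).
  have e0 : 0 < eps ^+ 2 / 4 by apply: divr_gt0 => //; exact: exprn_gt0.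
  exists j; rewrite -ler_pdivrMr // mul1r.
  apply: (@le_trans _ _ j%:R).
    by apply: ltW; apply: archi_boundP; rewrite invr_ge0 ltW.
  have : (j%:R : R) <= 2 ^+ j by rewrite -natrX ler_nat ltnW // ltn_expl.
  move=> /le_trans; apply; apply: lerXn2r; rewrite ?nnegrE; lra.
have exB : exists k, B k.
  exists 0; apply/asboolP; exists (fun=> p0); split => // i.
  by case: i.
have ubB k : B k -> (k <= Num.bound (V ^+ j))%N.
  move=> /asboolP[g [Pg sep]].
  have V0 : 0 <= V ^+ j.
    by apply: le_trans (separated_ball_card j Pg sep Pp0).
  rewrite -(ler_nat R) ltW // (le_lt_trans _ (archi_boundP V0)) //.
  apply: le_trans (separated_ball_card j Pg sep Pp0).
  rewrite ler_nat -[leqLHS]card_ord -cardsT; apply: subset_leq_card.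
  apply/fintype.subsetP => i _; rewrite inE (le_trans _ hj) //.
  by apply: hsq_le1; exact: Pd.
case: (ex_maxnP exB ubB) => k /asboolP[g [Pg sep]] kmax.
exists k, g; split => // p Pp; apply: contrapT => nex.
have far i : eps ^+ 2 < h2 p (g i).
  by rewrite ltNge; apply/negP => h; apply: nex; exists i.
suff : B k.+1 by move=> /kmax; rewrite ltnn.
apply/asboolP; exists (fun i => if unlift ord0 i is Some l then g l else p).
split; first by move=> i; case: unliftP.
move=> i i'; case: unliftP => [l|] ->; case: unliftP => [l'|] -> //.
- by rewrite (inj_eq (@lift_inj _ _)); exact: sep.
- by move=> _; rewrite hsqC.
Qed.

End Net.

(** * Selection of a centre by robust tests *)

Section Shells.
Context {R : realType}.

(* Up to the factor [eps ^+ 2 * ln alpha], the bound of [cover_kl_le] on the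
   divergence from the truth, [v] being the normalised squared distance. *)
Definition risk_profile (v : R) : R := 4 * ((9 + 4 * v) * (3 + 2 * v)).

Lemma risk_profile_le (u v : R) : 0 <= u -> u <= v ->
  risk_profile u <= risk_profile v.
Proof.
move=> u0 uv; rewrite ler_pM2l //.
by apply: ler_pM; lra.
Qed.

Lemma risk_profile_ge0 (v : R) : 0 <= v -> 0 <= risk_profile v.
Proof. by move=> v0; rewrite mulr_ge0 // mulr_ge0 //; lra. Qed.

(** The factor [expR (- (M * (l + 5)%:R))] is set aside to pay for the number of members in the
    shell. The rest of the exponent absorbs the quadratic growth of the profile and still leaves
    geometric decay. *)
Lemma shell_term_le (M v : R) (l : nat) : 1 <= M -> 64 * 4 ^+ l <= v ->
  risk_profile v * expR (- (M * (3 / 8 * v - 16)))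
    <= risk_profile 64 / 4 * 2^-1 ^+ l * expR (- (M * (l + 5)%:R)).
Proof.
move=> M1 lv.
have l4 : (l%:R : R) + 1 <= 4 ^+ l.
  elim: (l) => [|k IH]; first by rewrite expr0; lra.
  by rewrite exprS -natr1; have := ler0n R k; lra.
have l2 : (2 : R) ^+ l <= 4 ^+ l by apply: lerXn2r; rewrite ?nnegrE; lra.
have l1 : (1 : R) <= 4 ^+ l by rewrite exprn_ege1 //; lra.
have p2 : (0 : R) < 2 ^+ l by exact: exprn_gt0.
have -> : - (M * (3 / 8 * v - 16)) =
    - (M * (3 / 8 * v - 16 - (l + 5)%:R)) + - (M * (l + 5)%:R) by ring.
rewrite expRD mulrA; apply: ler_wpM2r; first exact: expR_ge0.
pose z := v - 64.
have z0 : 0 <= z by rewrite /z; lra.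
have EM : expR (- (M * (3 / 8 * v - 16 - (l + 5)%:R))) <= expR (- 3) * expR (- (19 / 64 * z)).
  rewrite -expRD ler_expR -opprD lerN2.
  (* At [v = 64 + z] one has 3/8 * 64 - 16 - 5 = 3, and [l <= z / 64] by [l4]. *)
  have h : 3 + 19 / 64 * z <= 3 / 8 * v - 16 - (l + 5)%:R.
    by rewrite /z natrD; lra.
  apply: (le_trans h); rewrite ler_peMl //.
  by apply: le_trans h; lra.
(* Exactly, [risk_profile v] is [risk_profile 64] times [(1 + 4 z / 265) (1 + 2 z / 131)]; moreover
   1/66 + 1/65 <= 1/32. *)
have F1 : risk_profile v <= risk_profile 64 * expR (z / 32).
  have e1 := expR_ge1Dx (z / 66); have e2 := expR_ge1Dx (z / 65).
  apply: (@le_trans _ _ (risk_profile 64 * ((1 + z / 66) * (1 + z / 65)))).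
    rewrite /risk_profile.
    have zz : 0 <= z * z by exact: mulr_ge0.
    by rewrite /z in zz *; lra.
  apply: ler_wpM2l; first by rewrite /risk_profile; lra.
  apply: (@le_trans _ _ (expR (z / 66) * expR (z / 65))).
    by apply: ler_pM => //; lra.
  by rewrite -expRD ler_expR; lra.
have h3 : expR (- 3) <= 4^-1 :> R.
  rewrite expRN lef_pV2 ?posrE ?expR_gt0 //.
  by have := @expR_ge1Dx R 3; lra.
have h4 : expR (z / 32) * expR (- (19 / 64 * z)) <= 2^-1 ^+ l.
  rewrite -expRD (_ : z / 32 + _ = - (17 / 64 * z)); last by lra.
  rewrite expRN exprVn lef_pV2 ?posrE ?expR_gt0 //.
  apply: le_trans (expR_ge1Dx _); rewrite /z; lra.
have P0 : 0 <= risk_profile 64 by exact: risk_profile_ge0.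
apply: (@le_trans _ _ ((risk_profile 64 * expR (z / 32)) *
    (expR (- 3) * expR (- (19 / 64 * z))))).
  apply: ler_pM F1 EM; last exact: expR_ge0.
  by apply: risk_profile_ge0; rewrite /z in z0; lra.
have -> : risk_profile 64 * expR (z / 32) * (expR (-3) * expR (- (19 / 64 * z)))
   = risk_profile 64 * (expR (-3) * (expR (z / 32) * expR (- (19 / 64 * z)))) by ring.
rewrite -[leRHS]mulrA; apply: ler_wpM2l => //.
apply: ler_pM h3 h4; first exact: expR_ge0.
by apply: mulr_ge0; exact: expR_ge0.
Qed.

Lemma sum_geometric_half (L : nat) : \sum_(l < L) (2^-1 : R) ^+ l <= 2.
Proof.
suff -> : \sum_(l < L) (2^-1 : R) ^+ l = 2 - 2 * 2^-1 ^+ L.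
  by have : (0 : R) <= 2^-1 ^+ L by [exact: exprn_ge0]; lra.
elim: L => [|L IH]; first by rewrite big_ord0 expr0; lra.
by rewrite big_ord_recr /= IH exprS; lra.
Qed.

(** Peeling: each index is charged to the first [l] with [v j <= 4 ^+ (l + 4)]. At most
    [expR M ^+ (l + 5)] indices satisfy this bound, which cancels the factor reserved in
    [shell_term_le] and leaves a geometric series. *)
Lemma shell_sum_le K (v : 'I_K -> R) (M : R) : 1 <= M ->
  (forall l, #|[set j | v j <= 4 ^+ l]%SET|%:R <= expR M ^+ l.+1) ->
  \sum_(j | 64 <= v j) risk_profile (v j) * expR (- (M * (3 / 8 * v j - 16)))
    <= risk_profile 64 / 2.
Proof.
move=> M1 cnt.
pose c l : R := risk_profile 64 / 4 * 2^-1 ^+ l * expR (- (M * (l + 5)%:R)).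
have c0 l : 0 <= c l.
  apply: mulr_ge0; last exact: expR_ge0.
  apply: mulr_ge0; last exact: exprn_ge0.
  by apply: divr_ge0 => //; exact: risk_profile_ge0.
have exl j : exists l, v j <= 4 ^+ (l + 4).
  exists (Num.bound (v j)); have [v0|v0] := leP 0 (v j).
    apply: (le_trans (ltW (archi_boundP v0))).
    rewrite -natrX ler_nat (leq_trans (ltnW (ltn_expl _ (isT : 1 < 4)%N))) //.
    by rewrite leq_exp2l // leq_addr.
  by rewrite (le_trans (ltW v0)) // exprn_ge0.
pose sh j := ex_minn (exl j).
pose L := (\max_(j < K) (sh j)).+1.
apply: (@le_trans _ _ (\sum_(j < K) \sum_(l < L) (v j <= 4 ^+ (l + 4))%R%:R * c l)).
  rewrite [leLHS]big_mkcond /=; apply: ler_sum => j _.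
  case: ifPn => [vj|_]; last by apply: sumr_ge0 => l _; apply: mulr_ge0.
  have jL : (sh j < L)%N by rewrite ltnS leq_bigmax.
  rewrite (bigD1 (Ordinal jL)) //= ler_wpDr //.
    by apply: sumr_ge0 => l _; apply: mulr_ge0.
  rewrite /sh; case: ex_minnP => l vl lmin.
  rewrite vl mul1r; apply: shell_term_le => //.
  (* In shell 0 the lower bound is the condition [64 <= v j]; later, minimality of the shell gives
     [v j > 4 ^+ (l + 4)], which is 64 times [4 ^+ l.+1]. *)
  case: l vl lmin => [|l] vl lmin; first by rewrite expr0 mulr1.
  have : ~~ (v j <= 4 ^+ (l + 4)) by apply/negP => /lmin; rewrite ltnn.
  rewrite -ltNge => /ltW; rewrite exprD => /(le_trans _); apply.
  by rewrite exprS; have : 0 <= (4 : R) ^+ l by [exact: exprn_ge0]; lra.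
rewrite exchange_big /=.
apply: (@le_trans _ _ (\sum_(l < L) risk_profile 64 / 4 * 2^-1 ^+ l)).
  apply: ler_sum => l _; rewrite -mulr_suml.
  have -> : \sum_(j < K) (v j <= 4 ^+ (l + 4))%R%:R =
      #|[set j | v j <= 4 ^+ (l + 4)]%SET|%:R :> R.
    rewrite -sum1_card natr_sum [RHS]big_mkcond /=.
    by apply: eq_bigr => j _; rewrite inE; case: ifP.
  rewrite /c mulrCA ler_piMr //.
    apply: mulr_ge0; last exact: exprn_ge0.
    by apply: divr_ge0 => //; exact: risk_profile_ge0.
  rewrite expRN ler_pdivrMr ?expR_gt0 // mul1r (le_trans (cnt _)) //.
  by rewrite -expRM_natr -addnS.
rewrite -mulr_sumr.
have P0 : 0 <= risk_profile 64 / 4 by apply: divr_ge0 => //; exact: risk_profile_ge0.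
by have := ler_wpM2l P0 (sum_geometric_half L); lra.
Qed.

End Shells.

Lemma measurable_prod_ord {d} {T : measurableType d} {R : realType} n
    (B : pred 'I_n) (h : 'I_n -> T -> R) :
  (forall i, measurable_fun [set: T] (h i)) ->
  measurable_fun [set: T] (fun x => \prod_(i < n | B i) h i x).
Proof.
move=> mh; under eq_fun do rewrite big_mkcond.
by apply: measurable_prod => i _; case: (B i).
Qed.

Section Selection.
Context {d} {T : measurableType d} {R : realType}
  (mu : {measure set T -> \bar R}).
Variables (n m K : nat) (g : 'I_K -> T -> R) (i0 : 'I_K).
Hypothesis gd : forall i, is_density mu (g i).
Local Notation h2 := (hellinger_sq mu).

Definition test_prod (p q : T -> R) (k : nat) (s : n.-tuple T) : R :=
  \prod_(i < n | (i < k)%N)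
    test_ratio (Num.sqrt (p (tnth s i))) (Num.sqrt (q (tnth s i))).

Lemma test_prod_gt0 p q k s : 0 < test_prod p q k s.
Proof. by apply: prodr_gt0 => i _; apply: test_ratio_gt0; exact: sqrtr_ge0. Qed.

Lemma test_prodV p q k s : test_prod q p k s = (test_prod p q k s)^-1.
Proof.
rewrite /test_prod -prodfV; apply: eq_bigr => i _.
by apply: test_ratioV; exact: sqrtr_ge0.
Qed.

Lemma measurable_test_prod p q k : is_density mu p -> is_density mu q ->
  measurable_fun [set: n.-tuple T] (test_prod p q k).
Proof.
move=> dp dq; apply: measurable_prod_ord => i.
apply: measurable_test_ratio; apply: measurable_fun_sqrt.
  exact: measurableT_comp (dens_measurable dp) (measurable_tnth i).
exact: measurableT_comp (dens_measurable dq) (measurable_tnth i).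
Qed.

Definition beaten (s : n.-tuple T) (i j : 'I_K) : bool :=
  1 <= test_prod (g i) (g j) m s.

Definition sel_loss (b : 'I_K -> 'I_K -> bool) (i : 'I_K) : R :=
  \big[Num.max/0]_(j | b i j) h2 (g i) (g j).

(** Taking only the finite table of test outcomes as argument makes both the measurability of the
    selection and its dependence on the first [m] coordinates visible. *)
Definition sel_of (b : 'I_K -> 'I_K -> bool) : 'I_K :=
  [arg min_(i < i0) sel_loss b i]%O.

Definition sel (s : n.-tuple T) : 'I_K := sel_of (beaten s).

Lemma beaten_total s i j : beaten s i j || beaten s j i.
Proof.
rewrite /beaten (test_prodV (g i) (g j)) invf_ge1 ?test_prod_gt0 //.
exact: le_total.
Qed.

(** If the selected member beats [i], their distance enters the loss of [i]; if [i] beats it, the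
    distance enters the loss of the selected member, which is minimal. *)
Lemma sel_le_loss s i : h2 (g i) (g (sel s)) <= sel_loss (beaten s) i.
Proof.
have smin : sel_loss (beaten s) (sel s) <= sel_loss (beaten s) i.
  by rewrite /sel /sel_of; case: arg_minP => // j _; apply.
have /orP[h|h] := beaten_total s i (sel s).
  exact: (le_bigmax_cond 0 (fun j => h2 (g i) (g j)) h).
apply: le_trans smin; rewrite hsqC.
exact: (le_bigmax_cond 0 (fun j => h2 (g (sel s)) (g j)) h).
Qed.

(** Meant for [i] nearest to the truth: a selection farther than [c] forces some member at least as
    far away to beat [i], and the sum is the union bound over such members. *)
Lemma sel_risk_le (F : R -> R) (c : R) s i : 0 <= c ->
  (forall u, 0 <= u -> 0 <= F u) -> (forall u v, 0 <= u -> u <= v -> F u <= F v) ->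
  F (h2 (g i) (g (sel s))) <= F c +
    \sum_(j | c <= h2 (g i) (g j)) (beaten s i j)%:R * F (h2 (g i) (g j)).
Proof.
move=> c0 F0 Fm; set x := h2 (g i) (g (sel s)).
have t0 j : 0 <= (beaten s i j)%:R * F (h2 (g i) (g j)).
  by apply: mulr_ge0 => //; apply: F0; exact: hsq_ge0.
have [xc|cx] := leP x c.
  by rewrite ler_wpDr ?sumr_ge0 //; apply: Fm => //; exact: hsq_ge0.
suff [j bj xj] : exists2 j, beaten s i j & x <= h2 (g i) (g j).
  rewrite (bigD1 j) /=; last exact: le_trans (ltW cx) xj.
  rewrite bj mul1r addrCA ler_wpDr //; last exact: Fm (hsq_ge0 _ _ _) xj.
  by rewrite addr_ge0 ?F0 // sumr_ge0.
apply: contrapT => nex; have := sel_le_loss s i; rewrite -/x leNgt => /negP; apply.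
apply/bigmax_ltP; split; first exact: le_lt_trans cx.
by move=> j bj; rewrite ltNge; apply/negP => xj; apply: nex; exists j.
Qed.

(** The selection takes its value through finitely many tables of outcomes, so the event is a finite
    union of finite intersections of test events. *)
Lemma measurable_sel i : measurable_fun [set: n.-tuple T] (fun s => sel s == i).
Proof.
have mb j k : measurable_fun [set: n.-tuple T] (fun s => beaten s j k).
  apply: measurable_fun_ler => //.
  by apply: measurable_test_prod; exact: gd.
apply: (measurable_fun_bool true); rewrite setTI.
pose b (c : {ffun 'I_K * 'I_K -> bool}) j k := c (j, k).
have -> : (fun s => sel s == i) @^-1` [set true] =
    \bigcup_(c in [set c | sel_of (b c) == i])
      \bigcap_(jk in [set: 'I_K * 'I_K])
        ((fun s => beaten s jk.1 jk.2) @^-1` [set c jk]).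
  apply/seteqP; split => [s /= si|s [c /= ci h]].
    exists [ffun jk : 'I_K * 'I_K => beaten s jk.1 jk.2].
      rewrite /= (_ : b _ = beaten s) //.
      by apply/funext => j; apply/funext => k; rewrite /b ffunE.
    by move=> jk _ /=; rewrite ffunE.
  rewrite /= /sel (_ : beaten s = b c) //.
  by apply/funext => j; apply/funext => k; exact: (h (j, k) I).
apply: fin_bigcup_measurable; first exact: finite_finset.
move=> c _; apply: fin_bigcap_measurable; first exact: finite_finset.
by move=> jk _; rewrite -[X in measurable X]setTI; exact: mb.
Qed.

End Selection.

Section TestError.
Context {d d'} {Omega : measurableType d'} {T : measurableType d}
  {R : realType} (Q : probability Omega R) (n : nat).
Variables (X : 'I_n -> {RV Q >-> T}) (x0 : T).
Variables (mu : {measure set T -> \bar R}) (ps : T -> R).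
Hypothesis dps : is_density mu ps.
Hypothesis iidX : iid_with_density mu ps X.
Local Notation h2 := (hellinger_sq mu).

Let tX w : n.-tuple T := [tuple X i w | i < n].
Let mtX : measurable_fun [set: Omega] tX := measurable_sample X.

Lemma integral_test_prod p q k : is_density mu p -> is_density mu q ->
  (k <= n)%N ->
  (\int[Q]_w (test_prod p q k (tX w))%:E = ((\int[mu]_x
    (ps x * test_ratio (Num.sqrt (p x)) (Num.sqrt (q x)))) ^+ k)%:E)%E.
Proof.
move=> dp dq; set I := Rintegral _ _ _.
elim: k => [_|k IH kn].
  rewrite expr0 /test_prod; under eq_integral do rewrite big_pred0 //.
  by rewrite integral_cst // mul1e; exact: probability_setT.
pose phi y := test_ratio (Num.sqrt (p y)) (Num.sqrt (q y)).
have mphi : measurable_fun [set: T] phi.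
  apply: measurable_test_ratio; apply: measurable_fun_sqrt.
    exact: dens_measurable dp.
  exact: dens_measurable dq.
have phi0 y : 0 <= phi y by apply: ltW; apply: test_ratio_gt0; exact: sqrtr_ge0.
pose f (z : n.-tuple T * T) := (test_prod p q k z.1 * phi z.2)%:E.
pose kO := Ordinal kn.
have tk s : test_prod p q k.+1 s = test_prod p q k s * phi (tnth s kO).
  rewrite /test_prod (bigD1 kO) //= mulrC; congr (_ * _).
  apply: eq_bigl => i; rewrite ltnS [RHS]ltn_neqAle andbC.
  by congr (_ && _).
have mtp : measurable_fun [set: n.-tuple T] (test_prod p q k).
  exact: measurable_test_prod dp dq.
have mf : measurable_fun [set: n.-tuple T * T] f.
  apply/measurable_EFinP; apply: measurable_funM.
    exact: measurableT_comp mtp measurable_fst.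
  exact: measurableT_comp mphi measurable_snd.
have f0 z : (0 <= f z)%E by rewrite lee_fin mulr_ge0 // ltW // test_prod_gt0.
have fk s s' y : (forall i : 'I_n, (i < kO)%N -> tnth s i = tnth s' i) ->
    f (s, y) = f (s', y).
  by move=> h; congr (_ * _)%:E; apply: eq_bigr => i ik; rewrite h.
have [_ E] := @integral_fresh_coord _ _ _ _ _ _ _ X x0 iidX.1 mu ps
  (dens_measurable dps) (dens_ge0 dps) iidX.2 kO f mf f0 fk.
transitivity (\int[Q]_w f (tX w, X kO w))%E.
  by apply: eq_integral => w _; rewrite tk /f /= tnth_mktuple.
rewrite E.
have iphi : mu.-integrable [set: T] (EFin \o (fun x => ps x * phi x)).
  exact: intble_test.
transitivity (\int[Q]_w ((test_prod p q k (tX w))%:E * I%:E))%E.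
  apply: eq_integral => w _.
  under eq_integral => y _ do rewrite /f /= -EFinM mulrAC -mulrA EFinM.
  rewrite integralZl //; congr (_ * _)%E.
  by rewrite /I /Rintegral fineK // integrable_fin_num.
have I0 : 0 <= I by apply: Rintegral_ge0 => x _; rewrite mulr_ge0 ?(dens_ge0 dps) //; exact: phi0.
rewrite ge0_integralZr //.
- by rewrite IH ?(ltnW kn) // -EFinM exprSr.
- by apply/measurable_EFinP; exact: measurableT_comp mtp mtX.
- by move=> w _; rewrite lee_fin ltW // test_prod_gt0.
Qed.

(** Markov's inequality at level 1 for the product of ratios, whose expectation is an [m]-th power
    by independence, followed by [1 - x <= expR (- x)]. *)
Lemma beaten_prob_le K (g : 'I_K -> T -> R) m i j :
  (forall i, is_density mu (g i)) -> (m <= n)%N ->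
  (\int[Q]_w (beaten m g (tX w) i j)%:R%:E <=
   (expR (- (m%:R * (3 / 8 * h2 (g i) (g j) - 16 * h2 ps (g i)))))%:E)%E.
Proof.
move=> gd mn.
apply: (@le_trans _ _ (\int[Q]_w (test_prod (g i) (g j) m (tX w))%:E)%E).
  have mtp : measurable_fun [set: n.-tuple T] (test_prod (g i) (g j) m).
    exact: measurable_test_prod (gd i) (gd j).
  apply: ge0_le_integral => //.
  - apply/measurable_EFinP.
    apply: (@measurableT_comp _ _ _ _ _ _ (fun b : bool => b%:R : R)) => //.
    apply: measurable_fun_ler => //.
    exact: measurableT_comp mtp mtX.
  - by apply/measurable_EFinP; exact: measurableT_comp mtp mtX.
  - move=> w _; rewrite lee_fin /beaten.
    by case: (leP 1 (test_prod _ _ _ _)) => //= _; rewrite ltW // test_prod_gt0.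
rewrite integral_test_prod // lee_fin.
set I := Rintegral _ _ _.
have I0 : 0 <= I.
  apply: Rintegral_ge0 => x _; rewrite mulr_ge0 ?(dens_ge0 dps) //.
  by apply: ltW; apply: test_ratio_gt0; exact: sqrtr_ge0.
have IE : I <= expR (- (3 / 8 * h2 (g i) (g j) - 16 * h2 ps (g i))).
  apply: (le_trans (test_expectation (gd i) (gd j) dps)).
  by apply: le_trans (expR_ge1Dx _); lra.
rewrite -mulrN expRM_natl; apply: lerXn2r => //.
by rewrite nnegrE expR_ge0.
Qed.

End TestError.

(** * Progressive mixtures *)

(** Jensen from the tangent line: the bounds [a k / S - 1] on [ln (a k / S)] sum to zero because [S]
    is the mean. *)
Lemma mean_ln_le {R : realType} (l : nat) (a : 'I_l.+1 -> R) :
  (forall k, 0 < a k) ->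
  l.+1%:R^-1 * \sum_k ln (a k) <= ln (\sum_k l.+1%:R^-1 * a k).
Proof.
move=> a0; rewrite -mulr_sumr; set S := l.+1%:R^-1 * \sum_k a k.
have S0 : 0 < S.
  rewrite mulr_gt0 ?invr_gt0 // big_ord_recl ltr_pwDl // sumr_ge0 // => k _.
  exact: ltW.
have h : \sum_k (ln (a k) - ln S) <= \sum_k (a k / S - 1).
  apply: ler_sum => k _; rewrite -ln_div ?posrE //.
  by apply: ler_ln_sub1; exact: divr_gt0.
have e : \sum_k (a k / S - 1) = 0.
  rewrite sumrB -mulr_suml sumr_const card_ord.
  have -> : \sum_k a k = l.+1%:R * S by rewrite /S mulrA divff ?mul1r.
  by rewrite mulfK ?subrr // gt_eqF.
move: h; rewrite e sumrB sumr_const card_ord subr_le0 => h.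
by rewrite mulrC ler_pdivrMr // mulr_natr.
Qed.

Section Mixture.
Context {d} {T : measurableType d} {R : realType}
  (mu : {measure set T -> \bar R}).
Variables (n m l N : nat) (q : 'I_N -> T -> R).
Hypothesis qd : forall j, is_density mu (q j).
Hypothesis N0 : (0 < N)%N.
Local Notation intble f := (mu.-integrable [set: T] (EFin \o f)).

Lemma dens_convex_sum (I : finType) (w : I -> R) (p : I -> T -> R) :
  (forall j, 0 <= w j) -> \sum_j w j = 1 -> (forall j, is_density mu (p j)) ->
  is_density mu (fun y => \sum_j w j * p j y).
Proof.
move=> w0 w1 pd; split.
- apply: measurable_sum => j; apply: measurable_funM => //.
  exact: dens_measurable (pd j).
- by move=> y; apply: sumr_ge0 => j _; rewrite mulr_ge0 // (dens_ge0 (pd j)).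
- under eq_integral do rewrite -sumEFin.
  rewrite ge0_integral_sum //.
  + rewrite -w1 -sumEFin; apply: eq_bigr => j _.
    under eq_integral do rewrite EFinM.
    rewrite ge0_integralZl //.
    * by case: (pd j) => _ _ ->; rewrite mule1.
    * by apply/measurable_EFinP; exact: dens_measurable (pd j).
    * by move=> y _; rewrite lee_fin (dens_ge0 (pd j)).
    * by rewrite lee_fin.
  + move=> j; apply/measurable_EFinP; apply: measurable_funM => //.
    exact: dens_measurable (pd j).
  + by move=> j y _; rewrite lee_fin mulr_ge0 // (dens_ge0 (pd j)).
Qed.

Definition window_prod (h : T -> R) (k : nat) (s : n.-tuple T) : R :=
  \prod_(i < n | (m <= i < m + k)%N) h (tnth s i).

Lemma measurable_window_prod h k : measurable_fun [set: T] h ->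
  measurable_fun [set: n.-tuple T] (window_prod h k).
Proof.
move=> mh; apply: measurable_prod_ord => i.
exact: measurableT_comp mh (measurable_tnth i).
Qed.

Lemma window_prod_ge0 h k s : (forall y, 0 <= h y) -> 0 <= window_prod h k s.
Proof. by move=> h0; apply: prodr_ge0. Qed.

Lemma window_prod0 h s : window_prod h 0 s = 1.
Proof.
by rewrite /window_prod big_pred0 // => i; rewrite addn0 ltnNge andbN.
Qed.

Lemma window_prodS h k s (i : 'I_n) : i = (m + k)%N :> nat ->
  window_prod h k.+1 s = window_prod h k s * h (tnth s i).
Proof.
move=> ik; rewrite /window_prod (bigD1 i) /= ?ik ?leq_addr ?addnS ?leqnn //.
rewrite mulrC; congr (_ * _); apply: eq_bigl => j.
rewrite -(inj_eq val_inj) /= ik ltnS [in RHS]ltn_neqAle -!andbA.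
by congr (_ && _); rewrite andbC.
Qed.

Lemma window_prod_prefix h k s s' :
  (forall i : 'I_n, (i < m + k)%N -> tnth s i = tnth s' i) ->
  window_prod h k s = window_prod h k s'.
Proof. by move=> e; apply: eq_bigr => i /andP[_ ik]; rewrite e. Qed.

(** Bayes weights for the uniform prior. The uniform default, for samples at which every likelihood
    vanishes, keeps the mixture a density for all samples. *)
Definition posterior (k : nat) (s : n.-tuple T) (j : 'I_N) : R :=
  let Z := \sum_j window_prod (q j) k s in
  if Z == 0 then N%:R^-1 else window_prod (q j) k s / Z.

(* Averaging the predictive mixtures over the sample size is what turns the
   cumulative regret bound [ln N] into the risk bound [ln N / (l + 1)]. *)
Definition prog_mixture (s : n.-tuple T) (y : T) : R :=
  \sum_(k < l.+1) l.+1%:R^-1 * \sum_j posterior k s j * q j y.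

Lemma posterior_ge0 k s j : 0 <= posterior k s j.
Proof.
rewrite /posterior; case: ifP => // _; rewrite divr_ge0 //.
  by apply: window_prod_ge0 => y; exact: dens_ge0 (qd j) y.
by apply: sumr_ge0 => i _; apply: window_prod_ge0 => y; exact: dens_ge0 (qd i) y.
Qed.

Lemma posterior_sum1 k s : \sum_j posterior k s j = 1.
Proof.
rewrite /posterior; case: (eqVneq (\sum_j window_prod (q j) k s) 0) => [_|Z0].
  by rewrite sumr_const card_ord -(mulr_natr N%:R^-1) mulVf // pnatr_eq0 -lt0n.
by rewrite -mulr_suml divff.
Qed.

Lemma prog_mixture_density s : is_density mu (prog_mixture s).
Proof.
apply: (@dens_convex_sum 'I_l.+1 (fun=> l.+1%:R^-1)
  (fun k y => \sum_j posterior k s j * q j y)) => //.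
  by rewrite sumr_const card_ord -(mulr_natr l.+1%:R^-1) mulVf.
move=> k; apply: dens_convex_sum => //; first exact: posterior_ge0.
exact: posterior_sum1.
Qed.

Lemma measurable_prog_mixture :
  measurable_fun [set: n.-tuple T * T] (fun z => prog_mixture z.1 z.2).
Proof.
apply: measurable_sum => k; apply: measurable_funM => //.
apply: measurable_sum => j; apply: measurable_funM; last first.
  exact: measurableT_comp (dens_measurable (qd j)) measurable_snd.
apply: (measurableT_comp (f := fun s => posterior k s j)) => //.
have mw i := measurable_window_prod k (dens_measurable (qd i)).
apply: measurable_fun_ifT => //.
  by apply: measurable_fun_eqr => //; exact: measurable_sum.
by apply: measurable_fun_div => //; exact: measurable_sum.
Qed.

Variables (ps : T -> R) (j0 : 'I_N) (A : R).
Hypothesis dps : is_density mu ps.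
Hypothesis A1 : 1 <= A.
Hypothesis psA : forall y, ps y <= A * q j0 y.

Let A0 : 0 <= A := le_trans ler01 A1.

(** The truth vanishes where [q j0] does, by [psA]. The default 1 there makes the ratio of [j0]
    identically 1, hence all evidences at least 1. *)
Definition lik_ratio (j : 'I_N) (y : T) : R :=
  if q j0 y == 0 then 1 else q j y / q j0 y.

Definition evidence (k : nat) (s : n.-tuple T) : R :=
  \sum_j window_prod (lik_ratio j) k s.

Definition next_evidence (k : nat) (s : n.-tuple T) (y : T) : R :=
  \sum_j window_prod (lik_ratio j) k s * lik_ratio j y.

Lemma lik_ratio_ge0 j y : 0 <= lik_ratio j y.
Proof.
by rewrite /lik_ratio; case: ifP => // _; apply: divr_ge0;
  [exact: dens_ge0 (qd j) y|exact: dens_ge0 (qd j0) y].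
Qed.

Lemma lik_ratio_ref y : lik_ratio j0 y = 1.
Proof. by rewrite /lik_ratio; case: eqP => // /eqP h; rewrite divff. Qed.

Lemma measurable_lik_ratio j : measurable_fun [set: T] (lik_ratio j).
Proof.
have mq i := dens_measurable (qd i).
apply: measurable_fun_ifT => //; first exact: measurable_fun_eqr.
exact: measurable_fun_div.
Qed.

Lemma ps_lik_ratio_le j y : ps y * lik_ratio j y <= A * q j y.
Proof.
have qj := dens_ge0 (qd j) y; have q0 := dens_ge0 (qd j0) y.
have p0 := dens_ge0 dps y; have := psA y.
rewrite /lik_ratio; case: eqP => [->|/eqP h].
  rewrite mulr0 mulr1 => pz; apply: (le_trans pz).
  exact: mulr_ge0.
move=> pA; apply: (@le_trans _ _ (A * q j0 y * (q j y / q j0 y))).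
  by apply: ler_wpM2r => //; exact: divr_ge0.
by rewrite -mulrA (mulrC (q j0 y)) divfK.
Qed.

Lemma evidence_ge1 k s : 1 <= evidence k s.
Proof.
rewrite /evidence (bigD1 j0) //=.
rewrite [X in X + _](_ : _ = 1); last first.
  by rewrite /window_prod big1 // => i _; rewrite lik_ratio_ref.
by rewrite lerDl sumr_ge0 // => j _; apply: window_prod_ge0; exact: lik_ratio_ge0.
Qed.

Lemma next_evidence_ge1 k s y : 1 <= next_evidence k s y.
Proof.
rewrite /next_evidence (bigD1 j0) //= lik_ratio_ref mulr1.
rewrite [X in X + _](_ : _ = 1); last first.
  by rewrite /window_prod big1 // => i _; rewrite lik_ratio_ref.
rewrite lerDl sumr_ge0 // => j _; rewrite mulr_ge0 ?lik_ratio_ge0 //.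
by apply: window_prod_ge0; exact: lik_ratio_ge0.
Qed.

Lemma evidence0 s : evidence 0 s = N%:R.
Proof.
rewrite /evidence; under eq_bigr do rewrite window_prod0.
by rewrite sumr_const card_ord.
Qed.

Lemma evidenceS k s (i : 'I_n) : i = (m + k)%N :> nat ->
  evidence k.+1 s = next_evidence k s (tnth s i).
Proof. by move=> ik; apply: eq_bigr => j _; exact: window_prodS. Qed.

Lemma next_evidence_prefix k s s' y :
  (forall i : 'I_n, (i < m + k)%N -> tnth s i = tnth s' i) ->
  next_evidence k s y = next_evidence k s' y.
Proof.
by move=> e; apply: eq_bigr => j _; rewrite (window_prod_prefix _ e).
Qed.

Lemma measurable_evidence k :
  measurable_fun [set: n.-tuple T] (evidence k).
Proof.
apply: measurable_sum => j; apply: measurable_window_prod.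
exact: measurable_lik_ratio.
Qed.

Lemma measurable_next_evidence k :
  measurable_fun [set: n.-tuple T * T] (fun z => next_evidence k z.1 z.2).
Proof.
have ml j := measurable_lik_ratio j.
apply: measurable_sum => j; apply: measurable_funM.
  exact: measurableT_comp (measurable_window_prod k (ml j)) measurable_fst.
exact: measurableT_comp (ml j) measurable_snd.
Qed.

Lemma intble_next_evidence k s :
  intble (fun y => ps y * next_evidence k s y).
Proof.
apply: (@intble_le _ _ _ _ _
  (fun y => \sum_j window_prod (lik_ratio j) k s * (A * q j y))).
- apply: measurable_funM; first exact: dens_measurable dps.
  apply: measurable_sum => j; apply: measurable_funM => //.
  exact: measurable_lik_ratio.
- move=> y; have p0 := dens_ge0 dps y.
  rewrite ger0_norm; last by rewrite mulr_ge0 // (le_trans _ (next_evidence_ge1 _ _ _)).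
  rewrite mulr_sumr; apply: ler_sum => j _; rewrite mulrCA.
  apply: ler_wpM2l; last exact: ps_lik_ratio_le.
  by apply: window_prod_ge0; exact: lik_ratio_ge0.
- rewrite (_ : _ \o _ = fun y => (\sum_j (window_prod (lik_ratio j) k s * (A * q j y))%:E)%E); last first.
    by apply/funext => y /=; rewrite sumEFin.
  apply: integrable_sum => // j _.
  apply: (@intbleZ _ _ _ _ (fun y => A * q j y)).
  by apply: intbleZ; exact: dens_integrable.
Qed.

(** A crude bound that keeps the expected evidence finite from one step to the next; [A] does not
    reach the risk bound. *)
Lemma next_evidence_int_le k s :
  \int[mu]_y (ps y * next_evidence k s y) <= A * evidence k s.
Proof.
have iq j : intble (fun y => A * q j y) by apply: intbleZ; exact: dens_integrable.
have iw j : intble (fun y => window_prod (lik_ratio j) k s * (A * q j y)).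
  exact: intbleZ.
suff : \int[mu]_y (ps y * next_evidence k s y) <=
    \int[mu]_y \sum_j window_prod (lik_ratio j) k s * (A * q j y).
  move=> /le_trans; apply.
  rewrite /Rintegral; under eq_integral do rewrite -sumEFin.
  rewrite integral_sum //.
  rewrite /evidence mulr_sumr.
  rewrite [X in fine X](_ : _ = (\sum_j A * window_prod (lik_ratio j) k s)%:E) //.
  rewrite -sumEFin; apply: eq_bigr => j _.
  transitivity (\int[mu]_y (window_prod (lik_ratio j) k s * (A * q j y)))%:E.
    by rewrite /Rintegral fineK // integrable_fin_num //; exact: iw.
  rewrite RintegralZl // RintegralZl ?dens_Rintegral ?mulr1 ?(mulrC A) //.
  exact: dens_integrable.
apply: le_RintegralT.
- exact: intble_next_evidence.
- rewrite (_ : _ \o _ = fun y => (\sum_j (window_prod (lik_ratio j) k s * (A * q j y))%:E)%E); last first.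
    by apply/funext => y /=; rewrite sumEFin.
  by apply: integrable_sum => // j _; exact: iw.
- move=> y; rewrite mulr_sumr; apply: ler_sum => j _; rewrite mulrCA.
  apply: ler_wpM2l; last exact: ps_lik_ratio_le.
  by apply: window_prod_ge0; exact: lik_ratio_ge0.
Qed.

Lemma intble_ln_next_evidence k s :
  intble (fun y => ps y * ln (next_evidence k s y)).
Proof.
apply: (intble_le _ _ (intble_next_evidence k s)).
- apply: measurable_funM; first exact: dens_measurable dps.
  apply: measurable_fun_ln; apply: measurable_sum => j.
  by apply: measurable_funM => //; exact: measurable_lik_ratio.
- move=> y; have p0 := dens_ge0 dps y; have u1 := next_evidence_ge1 k s y.
  rewrite ger0_norm ?mulr_ge0 ?ln_ge0 //; apply: ler_wpM2l => //.
  by have := @ler_ln_sub1 R (next_evidence k s y); lra.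
Qed.

(** The term [k = 0] has seen no data and carries uniform weights, so the mixture is at least
    [q j0 y / ((l + 1) N)]. *)
Lemma prog_mixture_dom s y : ps y <= l.+1%:R * N%:R * A * prog_mixture s y.
Proof.
have q0 j := dens_ge0 (qd j) y.
have t0 k : 0 <= l.+1%:R^-1 * \sum_j posterior k s j * q j y.
  by rewrite mulr_ge0 // sumr_ge0 // => j _; rewrite mulr_ge0 // posterior_ge0.
have NR : (0 : R) < N%:R by rewrite ltr0n.
have w0 j : posterior 0 s j = N%:R^-1.
  rewrite /posterior; case: ifP => // _; rewrite window_prod0 div1r; congr _^-1.
  by under eq_bigr do rewrite window_prod0; rewrite sumr_const card_ord.
have : l.+1%:R^-1 * (N%:R^-1 * q j0 y) <= prog_mixture s y.
  rewrite /prog_mixture big_ord_recl ler_wpDr //; first exact: sumr_ge0.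
  apply: ler_wpM2l => //; rewrite (bigD1 j0) //= w0 ler_wpDr // sumr_ge0 // => j _.
  by rewrite mulr_ge0 // posterior_ge0.
have c0 : 0 <= l.+1%:R * N%:R * A by rewrite mulr_ge0 ?mulr_ge0.
move=> /(ler_wpM2l c0); apply: le_trans.
have -> : l.+1%:R * N%:R * A * (l.+1%:R^-1 * (N%:R^-1 * q j0 y)) = A * q j0 y.
  have l0 : (l.+1%:R : R) != 0 by [].
  have n0 : (N%:R : R) != 0 by rewrite gt_eqF.
  by move: (l.+1%:R : R) (N%:R : R) l0 n0 => L M L0 M0; field; rewrite L0 M0.
exact: psA.
Qed.

(** Where [q j0] is nonzero at the relevant sample points, likelihoods factor through [lik_ratio],
    and each predictive density is [q j0] times [next_evidence / evidence]. Jensen then bounds the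
    logarithm of the average over [k] from below. *)
Lemma prog_mixture_kl_le s :
  (forall i : 'I_n, (m <= i)%N -> q j0 (tnth s i) != 0) ->
  \int[mu]_y (ps y * ln (ps y / prog_mixture s y)) <=
  \int[mu]_y (ps y * ln (ps y / q j0 y)) + l.+1%:R^-1 *
    \sum_(k < l.+1) (ln (evidence k s) -
      \int[mu]_y (ps y * ln (next_evidence k s y))).
Proof.
move=> good.
have NR : (1 : R) <= N%:R by rewrite ler1n.
have B1 : 1 <= l.+1%:R * N%:R * A.
  by rewrite mulr_ege1 // mulr_ege1 // ler1n.
have i1 := intble_kl dps (prog_mixture_density s) B1 (prog_mixture_dom s).
have i2 := intble_kl dps (qd j0) A1 psA.
have i3 (k : 'I_l.+1) : intble (fun y => ps y * (ln (evidence k s)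
    - ln (next_evidence k s y))).
  rewrite (_ : (fun y => _) = (fun y => ln (evidence k s) * ps y -
      ps y * ln (next_evidence k s y))); last by apply/funext => y; ring.
  apply: intbleB; last exact: intble_ln_next_evidence.
  by apply: intbleZ; exact: dens_integrable.
have i4 : intble (fun y => \sum_(k < l.+1) ps y * (ln (evidence k s)
    - ln (next_evidence k s y))).
  rewrite (_ : _ \o _ = fun y => (\sum_(k < l.+1) (ps y * (ln (evidence k s)
      - ln (next_evidence k s y)))%:E)%E); last first.
    by apply/funext => y /=; rewrite sumEFin.
  by apply: integrable_sum => // k _; exact: i3.
have E4 : \int[mu]_y (\sum_(k < l.+1) ps y * (ln (evidence k s)
    - ln (next_evidence k s y))) = \sum_(k < l.+1) (ln (evidence k s) -
      \int[mu]_y (ps y * ln (next_evidence k s y))).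
  rewrite {1}/Rintegral; under eq_integral do rewrite -sumEFin.
  rewrite integral_sum //.
  rewrite [X in fine X](_ : _ = (\sum_(k < l.+1) (ln (evidence k s) -
      \int[mu]_y (ps y * ln (next_evidence k s y))))%:E) //.
  rewrite -sumEFin; apply: eq_bigr => k _.
  transitivity (\int[mu]_y (ps y * (ln (evidence k s) - ln (next_evidence k s y))))%:E.
    by rewrite /Rintegral fineK // integrable_fin_num //; exact: i3.
  congr (_%:E).
  transitivity (\int[mu]_y (ln (evidence k s) * ps y - ps y * ln (next_evidence k s y))).
    by apply: eq_Rintegral => y _; ring.
  rewrite RintegralB //; last 2 first.
  - by apply: intbleZ; exact: dens_integrable.
  - exact: intble_ln_next_evidence.
  rewrite RintegralZl //; last exact: dens_integrable dps.
  by rewrite (dens_Rintegral dps) mulr1.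
rewrite -E4 -RintegralZl // -RintegralD //; last exact: intbleZ.
apply: le_RintegralT => //; first by apply: intbleD => //; exact: intbleZ.
move=> y; have p0 := dens_ge0 dps y.
have [->|/eqP pn0] := ps y =P 0.
  by rewrite !mul0r big1 ?mulr0 ?addr0 // => k _; rewrite mul0r.
have {}p0 : 0 < ps y by rewrite lt0r pn0.
have q0 : 0 < q j0 y.
  by rewrite -(@pmulr_rgt0 _ A) ?(lt_le_trans p0 (psA y)) // (lt_le_trans ltr01 A1).
have U0 k : 0 < evidence k s by rewrite (lt_le_trans _ (evidence_ge1 k s)).
have U'0 k : 0 < next_evidence k s y by rewrite (lt_le_trans _ (next_evidence_ge1 k s y)).
pose a (k : 'I_l.+1) := q j0 y * (next_evidence k s y / evidence k s).
have a0 k : 0 < a k by rewrite mulr_gt0 // divr_gt0.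
have mixE : prog_mixture s y = \sum_k l.+1%:R^-1 * a k.
  apply: eq_bigr => k _; congr (_ * _).
  have wE j : window_prod (q j) k s =
      window_prod (q j0) k s * window_prod (lik_ratio j) k s.
    rewrite /window_prod -big_split; apply: eq_bigr => i /andP[mi _] /=.
    have g := good i mi.
    by rewrite /lik_ratio (negbTE g) mulrC divfK.
  have w0 : 0 < window_prod (q j0) k s.
    apply: prodr_gt0 => i /andP[mi _].
    by rewrite lt0r (good i mi) (dens_ge0 (qd j0)).
  have ZE : \sum_j window_prod (q j) k s = window_prod (q j0) k s * evidence k s.
    by rewrite mulr_sumr; apply: eq_bigr => j _; exact: wE.
  have Z0 : 0 < \sum_j window_prod (q j) k s by rewrite ZE mulr_gt0.
  rewrite /a /next_evidence mulrA mulr_sumr mulr_suml; apply: eq_bigr => j _.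
  rewrite /posterior (gt_eqF Z0) ZE wE.
  have -> : lik_ratio j y = q j y / q j0 y by rewrite /lik_ratio (gt_eqF q0).
  have := U0 k; move: (evidence k s) => E E0.
  by field; rewrite !gt_eqF.
have := mean_ln_le a0; rewrite -mixE => h.
have m0 : 0 < prog_mixture s y.
  by rewrite mixE big_ord_recl ltr_pwDl ?mulr_gt0 ?invr_gt0 // sumr_ge0 // => k _;
    rewrite mulr_ge0 // ltW.
rewrite -mulr_sumr mulrCA -mulrDr; apply: ler_wpM2l; first exact: ltW.
rewrite !ln_div ?posrE //.
have lnE : \sum_k ln (a k) = l.+1%:R * ln (q j0 y) -
    \sum_(k < l.+1) (ln (evidence k s) - ln (next_evidence k s y)).
  rewrite mulr_natl -[X in _ *+ X]card_ord -sumr_const -sumrB.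
  apply: eq_bigr => k _; rewrite /a lnM ?posrE ?divr_gt0 // ln_div ?posrE //.
  by ring.
move: h; rewrite lnE mulrBr mulKf //.
move: (l.+1%:R^-1 * \sum_k (_ - _)) => Z h; lra.
Qed.

End Mixture.

Section MeasurableSelection.
Context {d} {S : measurableType d} {R : realType} (K : nat) (c : S -> 'I_K).
Hypothesis mc : forall i, measurable_fun [set: S] (fun s => c s == i).

Lemma measurable_fun_select (f : 'I_K -> S -> R) :
  (forall i, measurable_fun [set: S] (f i)) ->
  measurable_fun [set: S] (fun s => f (c s) s).
Proof.
move=> mf.
have -> : (fun s => f (c s) s) =
    (fun s => \sum_i (if c s == i then f i s else 0)).
  by apply/funext => s; rewrite -big_mkcond (big_pred1 (c s)).
apply: measurable_sum => i; exact: measurable_fun_ifT.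
Qed.

Lemma integrable_select (Q : probability S R) (f : 'I_K -> R) :
  Q.-integrable [set: S] (EFin \o (fun s => f (c s))).
Proof.
apply: (@intble_le _ _ _ _ _ (fun=> \sum_i `|f i|)) => //.
- exact: (measurable_fun_select (f := fun i _ => f i)).
- by move=> s; rewrite (bigD1 (c s)) //= lerDl sumr_ge0.
- exact: finite_measure_integrable_cst.
Qed.

End MeasurableSelection.

(* [f] need not be measurable, which spares us the measurability of the loss
   as a function of the sample. *)
Lemma ge0_integral_le_majorant {d} {T : measurableType d} {R : realType}
    (mu : {measure set T -> \bar R}) (f : T -> \bar R) (B : T -> R) (G : set T) :
  measurable G -> mu (~` G) = 0%E -> (forall x, (0 <= f x)%E) ->
  (forall x, G x -> (f x <= (B x)%:E)%E) ->
  mu.-integrable [set: T] (EFin \o B) ->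
  (\int[mu]_x f x <= \int[mu]_x (B x)%:E)%E.
Proof.
move=> mG G0 f0 fB iB.
have mB : measurable_fun [set: T] (EFin \o B) by exact: measurable_int iB.
pose h x : \bar R := if x \in G then (B x)%:E else +oo%E.
have mh : measurable_fun [set: T] h.
  apply: measurable_fun_ifT => //.
  apply: (measurable_fun_bool true); rewrite setTI.
  rewrite (_ : _ @^-1` _ = G) //; apply/seteqP; split=> x /=; first exact: set_mem.
  exact: mem_set.
have fh x : (f x <= h x)%E.
  rewrite /h; case: ifPn => [/set_mem /fB //|_]; exact: leey.
have -> : (\int[mu]_x (B x)%:E = \int[mu]_x h x)%E.
  apply: ae_eq_integral => //; exists (~` G); split => //.
    exact: measurableC.
  move=> x /= nh Gx; apply: nh => _.
  by rewrite /h mem_set.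
rewrite !ge0_integralTE //; last by move=> x; exact: le_trans (f0 x) (fh x).
apply: ge_ereal_sup => _ [k kf <-]; apply: ereal_sup_ubound; exists k => // x.
exact: le_trans (kf x) (fh x).
Qed.

(** * Risk of the mixture when its candidates are selected on the first half *)

Section SecondStage.
Context {d d'} {Omega : measurableType d'} {T : measurableType d}
  {R : realType} (Q : probability Omega R) (n m l K N : nat).
Variables (X : 'I_n -> {RV Q >-> T}) (x0 : T).
Variables (mu : {measure set T -> \bar R}) (ps : T -> R).
Hypothesis dps : is_density mu ps.
Hypothesis iidX : iid_with_density mu ps X.
Hypothesis mln : (m + l <= n)%N.
Hypothesis N0 : (0 < N)%N.
Variables (c : n.-tuple T -> 'I_K).
Hypothesis mc : forall i, measurable_fun [set: n.-tuple T] (fun s => c s == i).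
Hypothesis c_prefix : forall s s',
  (forall i : 'I_n, (i < m)%N -> tnth s i = tnth s' i) -> c s = c s'.
Variables (q : 'I_K -> 'I_N -> T -> R) (j0 : 'I_K -> 'I_N) (A : R).
Hypothesis qd : forall i j, is_density mu (q i j).
Hypothesis A1 : 1 <= A.
Hypothesis psA : forall i y, ps y <= A * q i (j0 i) y.

Let tX w : n.-tuple T := [tuple X i w | i < n].
Let mtX : measurable_fun [set: Omega] tX := measurable_sample X.

Let U k s := evidence m (q (c s)) (j0 (c s)) k s.
Let U' k s y := next_evidence m (q (c s)) (j0 (c s)) k s y.
Let kl i := \int[mu]_y (ps y * ln (ps y / q i (j0 i) y)).

Let U_ge1 k s : 1 <= U k s.
Proof. exact: evidence_ge1 (qd (c s)) _ _ _. Qed.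

Let U'_ge1 k s y : 1 <= U' k s y.
Proof. exact: next_evidence_ge1 (qd (c s)) _ _ _ _. Qed.

Let mU k : measurable_fun [set: n.-tuple T] (U k).
Proof.
apply: (measurable_fun_select mc (f := fun i => evidence m (q i) (j0 i) k)) => i.
exact: measurable_evidence (qd i) _ _.
Qed.

Let mU' k : measurable_fun [set: n.-tuple T * T] (fun z => U' k z.1 z.2).
Proof.
have mc1 i : measurable_fun [set: n.-tuple T * T] (fun z => c z.1 == i).
  exact: measurableT_comp (mc i) measurable_fst.
apply: (measurable_fun_select mc1
  (f := fun i z => next_evidence m (q i) (j0 i) k z.1 z.2)) => i.
exact: measurable_next_evidence (qd i) _ _.
Qed.

(** As [c] reads only the first [m] coordinates, observation [m + k] is still fresh once the
    candidates are selected and [k] further observations are used. *)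
Let fresh (F : R -> R) k : measurable_fun [set: R] F ->
  (forall u, 1 <= u -> 0 <= F u) -> (k < l)%N ->
  measurable_fun [set: Omega]
    (fun w => \int[mu]_y ((F (U' k (tX w) y))%:E * (ps y)%:E))%E /\
  (\int[Q]_w (F (U k.+1 (tX w)))%:E =
   \int[Q]_w \int[mu]_y ((F (U' k (tX w) y))%:E * (ps y)%:E))%E.
Proof.
move=> mF F0 kl'.
have ikn : (m + k < n)%N by rewrite (leq_trans _ mln) // ltn_add2l.
pose i := Ordinal ikn.
pose f (z : n.-tuple T * T) := (F (U' k z.1 z.2))%:E.
have mf : measurable_fun [set: n.-tuple T * T] f.
  by apply/measurable_EFinP; exact: measurableT_comp mF (mU' k).
have f0 z : (0 <= f z)%E by rewrite lee_fin F0.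
have fk s s' y : (forall j : 'I_n, (j < i)%N -> tnth s j = tnth s' j) ->
    f (s, y) = f (s', y).
  move=> e; rewrite /f /U' /= (c_prefix (s' := s')); last first.
    by move=> j jm; apply: e; rewrite /= ltn_addr.
  by congr (F _)%:E; apply: next_evidence_prefix.
have [mI E] := @integral_fresh_coord _ _ _ _ _ _ _ X x0 iidX.1 mu ps
  (dens_measurable dps) (dens_ge0 dps) iidX.2 i f mf f0 fk.
split => //; rewrite -E; apply: eq_integral => w _.
rewrite /f /= /U (@evidenceS _ _ _ _ _ _ _ _ k _ i) // tnth_mktuple //.
Qed.

Let integral_U k : (k <= l)%N ->
  (\int[Q]_w (U k (tX w))%:E <= (A ^+ k * N%:R)%:E)%E.
Proof.
elim: k => [_|k IH kl'].
  under eq_integral do rewrite /U evidence0.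
  rewrite integral_cst // expr0 mul1r [X in (_ * X)%E](_ : _ = 1%E) ?mule1 //.
  exact: probability_setT.
have [mI ->] := fresh (F := id) (@measurable_id _ _ _) (fun u u1 => le_trans ler01 u1) kl'.
apply: (@le_trans _ _ (\int[Q]_w (A%:E * (U k (tX w))%:E))%E).
  apply: ge0_le_integral => //.
  - by move=> w _; apply: integral_ge0 => y _; rewrite -EFinM lee_fin mulr_ge0 ?(dens_ge0 dps) // (le_trans ler01).
  - apply/measurable_EFinP; apply: measurable_funM => //.
    exact: measurableT_comp (mU k) mtX.
  - move=> w _; rewrite -EFinM.
    under eq_integral do rewrite -EFinM mulrC.
    have := next_evidence_int_le m (qd (c (tX w))) dps A1 (psA (c (tX w))) k (tX w).
    rewrite -lee_fin; apply: le_trans.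
    rewrite /Rintegral fineK // integrable_fin_num //.
    have h := intble_next_evidence m (qd (c (tX w))) dps A1 (psA (c (tX w))) k (tX w).
    exact: h.
rewrite ge0_integralZl //.
- rewrite exprS -mulrA [(A * _)%:E]EFinM; apply: lee_wpmul2l; last exact: IH (ltnW kl').
  by rewrite lee_fin (le_trans ler01).
- by apply/measurable_EFinP; exact: measurableT_comp (mU k) mtX.
- by move=> w _; rewrite lee_fin (le_trans ler01).
- by rewrite lee_fin (le_trans ler01).
Qed.

Let intble_lnU k : (k <= l)%N ->
  Q.-integrable [set: Omega] (EFin \o (fun w => ln (U k (tX w)))).
Proof.
move=> kl'; apply: (@intble_le _ _ _ _ _ (fun w => U k (tX w))).
- apply: measurable_fun_ln; exact: measurableT_comp (mU k) mtX.
- move=> w; have u1 := U_ge1 k (tX w); rewrite ger0_norm ?ln_ge0 //.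
  by have := @ler_ln_sub1 R (U k (tX w)); lra.
- apply/integrableP; split.
    by apply/measurable_EFinP; exact: measurableT_comp (mU k) mtX.
  under eq_integral do rewrite /= ger0_norm ?(le_trans ler01) //.
  by rewrite (le_lt_trans (integral_U kl')) // ltry.
Qed.

Let Dk k w := \int[mu]_y (ps y * ln (U' k (tX w) y)).

Let DkE k w : (\int[mu]_y ((ln (U' k (tX w) y))%:E * (ps y)%:E) = (Dk k w)%:E)%E.
Proof.
rewrite /Dk /Rintegral fineK; last first.
  rewrite integrable_fin_num //.
  have h := intble_ln_next_evidence m (qd (c (tX w))) dps A1 (psA (c (tX w))) k (tX w).
  exact: h.
by apply: eq_integral => y _; rewrite -EFinM mulrC.
Qed.

Let Dk_ge0 k w : 0 <= Dk k w.
Proof.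
by apply: Rintegral_ge0 => y _; rewrite mulr_ge0 ?(dens_ge0 dps) // ln_ge0.
Qed.

(** [U k.+1] is [U' k] evaluated at the fresh observation, and [Dk k] averages its logarithm over
    that observation. This equality makes the regret telescope in expectation. *)
Let Dk_int k : (k < l)%N ->
  Q.-integrable [set: Omega] (EFin \o Dk k) /\
  \int[Q]_w Dk k w = \int[Q]_w ln (U k.+1 (tX w)).
Proof.
move=> kl'.
have [mI E] := fresh (F := @ln R) (@measurable_ln R) (fun u u1 => ln_ge0 u1) kl'.
have mD : measurable_fun [set: Omega] (EFin \o Dk k).
  by rewrite (_ : _ \o _ = fun w => \int[mu]_y ((ln (U' k (tX w) y))%:E * (ps y)%:E))%E //;
    apply/funext => w; rewrite DkE.
have E2 : (\int[Q]_w (Dk k w)%:E = \int[Q]_w (ln (U k.+1 (tX w)))%:E)%E.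
  by rewrite E; apply: eq_integral => w _; rewrite DkE.
split; last by rewrite /Rintegral E2.
apply/integrableP; split => //.
under eq_integral do rewrite /= ger0_norm //.
by rewrite E2 integrable_lty //; exact: intble_lnU.
Qed.

Lemma prog_mixture_risk :
  (\int[Q]_w KL mu ps (prog_mixture m l (q (c (tX w))) (tX w)) <=
   (\int[Q]_w kl (c (tX w)) + ln N%:R / l.+1%:R)%:E)%E.
Proof.
pose Z i : set T := [set y | q i (j0 i) y = 0].
have mZ i : measurable (Z i).
  rewrite -[Z i]setTI.
  exact: (dens_measurable (qd i (j0 i))) (measurable_set1 0).
(* Off [G] some observation falls on a zero of a comparison density, where the truth vanishes too: a
   null event. *)
pose G : set Omega := ~` \bigcup_(ij in [set: 'I_K * 'I_n]) (X ij.2 @^-1` Z ij.1).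
have mXZ i j : measurable (X j @^-1` Z i) by exact: measurable_funPTI.
have mG : measurable G.
  apply: measurableC; apply: fin_bigcup_measurable; first exact: finite_finset.
  by move=> ij _.
have QXZ i j : Q (X j @^-1` Z i) = 0%E.
  have := iidX.2 j (Z i) (mZ i); rewrite /distribution /pushforward => ->.
  apply: integral0_eq => y /= yz.
  have := psA i y; rewrite yz mulr0 => h.
  by congr (_%:E); apply/eqP; rewrite eq_le h (dens_ge0 dps).
have QG : Q (~` G) = 0%E.
  apply/eqP; rewrite eq_le measure_ge0 andbT.
  have /= h := @content_sub_fsum _ _ _ Q _ [set: 'I_K * 'I_n] (~` G)
    (fun ij => X ij.2 @^-1` Z ij.1) finite_finset.
  apply: (le_trans (h _ _ _)) => //.
  - exact: measurableC.
  - by rewrite setCK.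
  - by rewrite fsbig1 // => ij _; exact: QXZ.
pose B w := kl (c (tX w)) + l.+1%:R^-1 *
  (ln N%:R + \sum_(k < l) (ln (U k.+1 (tX w)) - Dk k w)).
have ikl : Q.-integrable [set: Omega] (EFin \o (fun w => kl (c (tX w)))).
  have mcX i : measurable_fun [set: Omega] (fun w => c (tX w) == i).
    exact: measurableT_comp (mc i) mtX.
  exact: (integrable_select mcX).
have iD (k : 'I_l) : Q.-integrable [set: Omega]
    (EFin \o (fun w => ln (U k.+1 (tX w)) - Dk k w)).
  by apply: intbleB; [exact: intble_lnU|case: (Dk_int (ltn_ord k))].
have iN : Q.-integrable [set: Omega] (EFin \o (fun w : Omega => ln N%:R : R)).
  exact: finite_measure_integrable_cst.
have iS : Q.-integrable [set: Omega]
    (EFin \o (fun w => \sum_(k < l) (ln (U k.+1 (tX w)) - Dk k w))).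
  rewrite (_ : _ \o _ = fun w => (\sum_(k < l) (ln (U k.+1 (tX w)) - Dk k w)%:E)%E); last first.
    by apply/funext => w /=; rewrite sumEFin.
  by apply: integrable_sum => // k _; exact: iD.
have iB : Q.-integrable [set: Omega] (EFin \o B).
  by apply: intbleD => //; apply: intbleZ; exact: intbleD.
have EB : (\int[Q]_w (B w)%:E)%E = (\int[Q]_w kl (c (tX w)) + ln N%:R / l.+1%:R)%:E.
  transitivity (\int[Q]_w B w)%:E.
    by rewrite /Rintegral fineK // integrable_fin_num.
  congr (_%:E); rewrite /B RintegralD //; last by apply: intbleZ; exact: intbleD.
  rewrite RintegralZl ?RintegralD //; last exact: intbleD.
  have -> : \int[Q]_w (ln N%:R : R) = ln N%:R.
    rewrite Rintegral_cst // [X in fine X](_ : _ = 1%E) ?mulr1 //.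
    exact: probability_setT.
  have -> : \int[Q]_w (\sum_(k < l) (ln (U k.+1 (tX w)) - Dk k w)) = 0.
    rewrite /Rintegral; under eq_integral do rewrite -sumEFin.
    rewrite integral_sum // big1 // => k _.
    transitivity (\int[Q]_w (ln (U k.+1 (tX w)) - Dk k w))%:E.
      by rewrite /Rintegral fineK // integrable_fin_num //; exact: iD.
    have [iDk EDk] := Dk_int (ltn_ord k).
    by rewrite RintegralB // ?EDk ?subrr //; exact: intble_lnU.
  by rewrite addr0 mulrC.
have C1 : 1 <= l.+1%:R * N%:R * A.
  by rewrite mulr_ege1 // mulr_ege1 // ler1n.
have dom i := prog_mixture_dom (n := n) m l (qd i) N0 A1 (psA i).
have dm i := prog_mixture_density (n := n) m l (qd i) N0.
rewrite -EB; apply: (ge0_integral_le_majorant mG QG) => //.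
- move=> w; rewrite (KLE dps (dm _ _) C1 (dom _ _)) lee_fin.
  exact: kl_ge0 dps (dm _ _) C1 (dom _ _).
- move=> w Gw; rewrite (KLE dps (dm _ _) C1 (dom _ _)) lee_fin.
  have good (i : 'I_n) : (m <= i)%N ->
      q (c (tX w)) (j0 (c (tX w))) (tnth (tX w) i) != 0.
    move=> _; apply/eqP => h; apply: Gw; exists (c (tX w), i) => //=.
    by rewrite /Z /= -[X i w](tnth_mktuple (fun i => X i w)).
  have h := prog_mixture_kl_le l (qd (c (tX w))) N0 dps A1 (psA (c (tX w))) good.
  refine (le_trans h _).
  rewrite /B lerD2l; apply: ler_wpM2l; first by rewrite invr_ge0.
  (* [U 0] is [N], each [ln (U k.+1)] is paired with [Dk k], and the unpaired [Dk l] is nonnegative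
     and dropped. Hence [l + 1] mixtures cost only [l] observations. *)
  rewrite sumrB big_ord_recl /= (evidence0 _ (q (c (tX w)))) sumrB.
  rewrite -addrA lerD2l lerD2l lerN2 big_ord_recr /= ler_wpDr //.
  exact: Dk_ge0.
Qed.

End SecondStage.

(** * Combination of the two stages *)

Lemma half_le_ln {R : realType} (alpha : R) : 2 <= alpha -> 1 / 2 <= ln alpha.
Proof.
move=> a2; have a0 : 0 < alpha by lra.
have := @ler_ln_sub1 R alpha^-1; rewrite invr_gt0 lnV ?posrE // => /(_ a0).
suff : alpha^-1 <= 1 / 2 by lra.
by rewrite -div1r ler_pdivrMr //; lra.
Qed.

Lemma convex_class_mix {d} {T : measurableType d} {R : realType}
    (P : set (T -> R)) (p q : T -> R) (t : R) :
  convex_class P -> P p -> P q -> 0 <= t <= 1 ->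
  P (fun x => (1 - t) * p x + t * q x).
Proof.
move=> cP Pp Pq /andP[t0 t1].
have h := cP q p (Itv01 t0 t1) (mem_set Pq) (mem_set Pp).
move: (set_mem h); congr P; apply/funext => x.
by rewrite addrC.
Qed.

Section CoverConsequences.
Context {d} {T : measurableType d} {R : realType}
  (mu : {measure set T -> \bar R}).
Variables (P : set (T -> R)) (eps alpha v : R).
Hypothesis Pd : forall p, P p -> is_density mu p.
Hypothesis Pconv : convex_class P.
Hypothesis eps0 : 0 < eps.
Hypothesis alpha2 : 2 <= alpha.
Hypothesis v0 : 0 <= v.
Local Notation h2 := (hellinger_sq mu).

(* Moving from [p] towards [s] by the fraction [1 / (2 + 2 v)] stays in the
   covered ball, so a centre of the cover at [p] dominates even a density [s]
   outside this ball. *)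
Lemma cover_dominates N (q : 'I_N -> T -> R) (p s : T -> R) : P p -> P s ->
  h2 p s <= (2 + 2 * v) * eps ^+ 2 ->
  (forall r, P r -> h2 p r <= eps ^+ 2 ->
    exists j, forall x, r x <= alpha * q j x) ->
  exists j, forall x, s x <= alpha * (2 + 2 * v) * q j x.
Proof.
move=> Pp Ps ps cov; have w0 : 0 < 2 + 2 * v by have := v0; lra.
pose t := (2 + 2 * v)^-1.
have t0 : 0 < t by rewrite invr_gt0.
have t1 : t <= 1 by rewrite invf_le1 //; have := v0; lra.
have t01 : 0 <= t <= 1 by rewrite ltW.
have Pr := convex_class_mix Pconv Pp Ps t01.
have [j hj] : exists j, forall x, (1 - t) * p x + t * s x <= alpha * q j x.
  apply: cov => //; apply: (le_trans (hsq_mix (Pd Pp) (Pd Ps) (Pd Pr) t01)).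
  by rewrite /t mulrC ler_pdivrMr // mulrC.
exists j => x; have := hj x; have p0 := dens_ge0 (Pd Pp) x => h.
have : t * s x <= alpha * q j x.
  apply: le_trans h; rewrite lerDr mulr_ge0 //; lra.
by rewrite /t mulrC ler_pdivrMr // mulrAC.
Qed.

(** The quasi-triangle inequality through [p] gives the factor 2 (2 + 2 v) + 2 = 6 + 4 v. Since
    [ln alpha >= 1/2], additive constants become multiples of [ln alpha], giving 9 + 4 v; twice the
    product is [risk_profile v]. *)
Lemma cover_kl_le (q s : T -> R) (p : T -> R) :
  is_density mu p -> is_density mu q -> is_density mu s ->
  h2 p s <= (2 + 2 * v) * eps ^+ 2 -> h2 p q <= eps ^+ 2 ->
  (forall x, s x <= alpha * (2 + 2 * v) * q x) ->
  \int[mu]_x (s x * ln (s x / q x)) <= eps ^+ 2 * ln alpha * risk_profile v.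
Proof.
move=> dp dq ds ps pq sq.
have a2 := alpha2; have vv := v0.
have A1 : 1 <= alpha * (2 + 2 * v) by rewrite mulr_ege1 //; lra.
apply: (le_trans (kl_le_hsq ds dq A1 sq)).
have la := half_le_ln alpha2.
have e0 : 0 <= eps ^+ 2 by exact: sqr_ge0.
have hq : h2 s q <= (6 + 4 * v) * eps ^+ 2.
  have := hsq_quasi_triangle ds dp dq; rewrite (hsqC mu s p); lra.
have hA : 3 + ln (alpha * (2 + 2 * v)) <= ln alpha * (9 + 4 * v).
  have w0 : 0 < 2 + 2 * v by lra.
  have lw := ler_ln_sub1 w0.
  rewrite lnM ?posrE //; last lra.
  have : 0 <= (ln alpha - 1 / 2) * (8 + 4 * v) by apply: mulr_ge0; lra.
  lra.
have l0 : 0 <= 3 + ln (alpha * (2 + 2 * v)) by have := ln_ge0 A1; lra.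
rewrite -mulrA.
have := ler_pM l0 (hsq_ge0 mu s q) hA hq.
by rewrite /risk_profile; lra.
Qed.

End CoverConsequences.

Lemma local_entropy_le_exp {R : realType} (x : \bar R) (M : R) :
  (maxe (lne x) 1 <= M%:E)%E -> 1 <= M /\ (x <= (expR M)%:E)%E.
Proof.
rewrite ge_max => /andP[h1 h2]; split; first by rewrite lee_fin in h2.
case: x h1 => [r| |] /=; last 2 first.
- by rewrite leye_eq.
- by move=> _; exact: leNye.
case: (leP r 0) => [r0 _|r0]; rewrite !lee_fin.
  exact: le_trans r0 (expR_ge0 M).
by rewrite -ler_expR lnK.
Qed.

Section FirstStageRisk.
Context {d d'} {Omega : measurableType d'} {T : measurableType d}
  {R : realType} (Q : probability Omega R) (n m K : nat).
Variables (X : 'I_n -> {RV Q >-> T}) (x0 : T).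
Variables (mu : {measure set T -> \bar R}) (ps : T -> R).
Hypothesis dps : is_density mu ps.
Hypothesis iidX : iid_with_density mu ps X.
Hypothesis mn : (m <= n)%N.
Variables (g : 'I_K -> T -> R) (i0 i1 : 'I_K) (eps : R).
Hypothesis gd : forall i, is_density mu (g i).
Hypothesis eps0 : 0 < eps.
Hypothesis g1 : hellinger_sq mu ps (g i1) <= eps ^+ 2.
Let M := m%:R * eps ^+ 2.
Hypothesis M1 : 1 <= M.
Local Notation h2 := (hellinger_sq mu).
Hypothesis g_card : forall j,
  #|[set i | h2 (g i1) (g i) <= 4 ^+ j * (eps ^+ 2 / 4)]%SET|%:R <= expR M ^+ j.

Let tX w : n.-tuple T := [tuple X i w | i < n].
Let mtX : measurable_fun [set: Omega] tX := measurable_sample X.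
Let v i := h2 (g i1) (g i) / eps ^+ 2.

Let e20 : 0 < eps ^+ 2. Proof. exact: exprn_gt0. Qed.

Let shells : \sum_(j | 64 <= v j) risk_profile (v j) *
    expR (- (M * (3 / 8 * v j - 16))) <= risk_profile 64 / 2.
Proof.
apply: shell_sum_le => // l; apply: le_trans (g_card l.+1).
rewrite ler_nat; apply: subset_leq_card; apply/fintype.subsetP => j.
rewrite !inE /v ler_pdivrMr // => /le_trans; apply.
by have -> : (4 : R) ^+ l.+1 = 4 * 4 ^+ l by [rewrite exprS]; lra.
Qed.

(** With threshold 64 in [sel_risk_le], near selections cost at most [risk_profile 64] and the
    shells beyond add at most half of it. *)
Lemma first_stage_risk :
  \int[Q]_w risk_profile (v (sel mu m g i0 (tX w))) <= 3 / 2 * risk_profile 64.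
Proof.
have vF u : 0 <= u -> 0 <= risk_profile (u / eps ^+ 2).
  by move=> u0; apply: risk_profile_ge0; exact: divr_ge0 (ltW e20).
pose b j w : R := (beaten m g (tX w) i1 j)%:R.
have mb j : measurable_fun [set: Omega] (b j).
  apply: (@measurableT_comp _ _ _ _ _ _ (fun x : bool => x%:R : R)) => //.
  apply: measurable_fun_ler => //.
  have mt : measurable_fun [set: n.-tuple T] (test_prod (g i1) (g j) m).
    exact: measurable_test_prod (gd i1) (gd j).
  exact: measurableT_comp mt mtX.
have ib j : Q.-integrable [set: Omega] (EFin \o b j).
  apply: (@intble_le _ _ _ _ _ (fun=> 1)) => //.
    by move=> w; rewrite /b; case: (beaten _ _ _ _ _); rewrite ?normr1 ?normr0.
  exact: finite_measure_integrable_cst.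
have ibF j : Q.-integrable [set: Omega] (EFin \o (fun w => risk_profile (v j) * b j w)).
  exact: intbleZ.
pose S w := \sum_(j | 64 <= v j) risk_profile (v j) * b j w.
have iS : Q.-integrable [set: Omega] (EFin \o S).
  rewrite (_ : _ \o _ = fun w => (\sum_(j | (64 <= v j)%R) (risk_profile (v j) * b j w)%:E)%E); last first.
    by apply/funext => w /=; rewrite sumEFin.
  by apply: integrable_sum => // j _; exact: ibF.
have iC : Q.-integrable [set: Omega] (EFin \o (fun _ : Omega => risk_profile 64 : R)).
  exact: finite_measure_integrable_cst.
have mc i : measurable_fun [set: Omega] (fun w => sel mu m g i0 (tX w) == i).
  have ms : measurable_fun [set: n.-tuple T] (fun s => sel mu m g i0 s == i).
    exact: measurable_sel.
  exact: measurableT_comp ms mtX.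
have ptw w : risk_profile (v (sel mu m g i0 (tX w))) <= risk_profile 64 + S w.
  have := @sel_risk_le _ _ _ mu _ m _ g i0 (fun u => risk_profile (u / eps ^+ 2))
    (64 * eps ^+ 2) (tX w) i1.
  have e1 : 0 <= 64 * eps ^+ 2 by rewrite mulr_ge0 // ltW.
  have mono u u' : 0 <= u -> u <= u' ->
      risk_profile (u / eps ^+ 2) <= risk_profile (u' / eps ^+ 2).
    move=> u0 uu; apply: risk_profile_le; first exact: divr_ge0 (ltW e20).
    by rewrite ler_pM2r // invr_gt0.
  move=> /(_ e1 vF mono); rewrite mulfK ?gt_eqF // => /le_trans; apply.
  rewrite lerD2l /S.
  under [leLHS]eq_bigl do rewrite -ler_pdivlMr //.
  by apply: ler_sum => j _; rewrite mulrC.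
have iR : Q.-integrable [set: Omega]
    (EFin \o (fun w => risk_profile (v (sel mu m g i0 (tX w))))).
  exact: (integrable_select mc Q (fun i => risk_profile (v i))).
apply: (le_trans (le_RintegralT iR (intbleD iC iS) ptw)).
rewrite RintegralD // Rintegral_cst // [X in fine X](_ : _ = 1%E); last first.
  exact: probability_setT.
rewrite mulr1.
suff : \int[Q]_w S w <= risk_profile 64 / 2 by lra.
apply: le_trans shells.
rewrite -lee_fin /Rintegral fineK ?integrable_fin_num //.
under eq_integral do rewrite -sumEFin.
rewrite integral_sum // -sumEFin; apply: lee_sum => j _.
under eq_integral do rewrite EFinM.
rewrite ge0_integralZl //; last 3 first.
- exact/measurable_EFinP.
- by move=> w _; rewrite lee_fin.
- by rewrite lee_fin; apply: vF; exact: hsq_ge0.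
rewrite [leRHS]EFinM; apply: lee_wpmul2l; first by rewrite lee_fin; apply: vF; exact: hsq_ge0.
apply: (le_trans (beaten_prob_le x0 dps iidX i1 j gd mn)).
rewrite lee_fin ler_expR lerN2 /M -mulrA; apply: ler_wpM2l => //.
have -> : h2 (g i1) (g j) = v j * eps ^+ 2 by rewrite /v divfK // gt_eqF.
by have := g1; lra.
Qed.

End FirstStageRisk.

(** A round number between 208290 and the announced constant. The large literal is unfolded into
    multiplications by ten, which avoids a unary numeral. *)
Lemma le_366609 {R : realType} : 600 * 600 <= 366609%:R :> R.
Proof.
rewrite -natrM ler_nat; cbv [Nat.of_num_uint Nat.of_uint Nat.of_uint_acc].
rewrite !PeanoNat.Nat.tail_mul_spec; lia.
Qed.

Theorem proposition1 (R : realType) (d : measure_display)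
    (T : measurableType d) (mu : {measure set T -> \bar R})
    (n : nat) (n_ge2 : (2 <= n)%N) (n_even : ~~ odd n)
    (P : set (T -> R)) (P_nonempty : P !=set0)
    (P_density : forall p, P p -> is_density mu p) (P_convex : convex_class P)
    (eps : R) (eps_gt0 : 0 < eps)
    (eps_entropy :
      (maxe (lne (local_entropy mu P eps)) 1 <= (n%:R / 2 * eps ^+ 2)%:E)%E)
    (alpha : R) (alpha_ge2 : 2 <= alpha) (NS : nat) (NS_ge1 : (1 <= NS)%N)
    (covers : forall p, P p -> exists S : set (T -> R),
      [/\ S `<=` P `&` hellinger_sq_ball mu p (eps ^+ 2),
          S #<= `I_NS
        & ratio_cover alpha (P `&` hellinger_sq_ball mu p (eps ^+ 2)) S]) :
  exists phat : n.-tuple T -> T -> R,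
    is_estimator mu phat /\
    forall pstar, P pstar ->
    forall (d' : measure_display) (Omega : measurableType d')
      (Q : probability Omega R) (X : 'I_n -> {RV Q >-> T}),
      iid_with_density mu pstar X ->
      (\int[Q]_w KL mu pstar (phat [tuple X i w | i < n])
       <= (366609%:R * eps ^+ 2 * ln alpha + ln NS%:R / (n%:R / 2 + 1))%:E)%E.
Proof.
have [M1 entV] := local_entropy_le_exp eps_entropy.
have [m nE] : exists m, n = (m + m)%N.
  by exists n./2; rewrite addnn even_halfK.
have nR : n%:R / 2 = m%:R :> R by rewrite nE natrD; lra.
move: M1 entV; rewrite nR; set M := m%:R * eps ^+ 2 => M1 entV.
have [K [g [Pg gsep gnet]]] := net_exists P_density eps_gt0 entV P_nonempty.
have [i0 _] : exists i : 'I_K, True.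
  by have [p0 /gnet[i _]] := P_nonempty; exists i.
have gd i : is_density mu (g i) := P_density _ (Pg i).
have cov i : exists q : 'I_NS -> T -> R,
    [/\ forall j, P (q j), forall j, hellinger_sq mu (g i) (q j) <= eps ^+ 2 &
      forall r, P r -> hellinger_sq mu (g i) r <= eps ^+ 2 ->
        exists j, forall x, r x <= alpha * q j x].
  have [S [SP Scard Scov]] := covers _ (Pg i).
  have Sn : S !=set0.
    have [|r Sr _] := Scov (g i); last by exists r.
    by split => //; split => //; rewrite hsqxx sqr_ge0.
  have [q [Sq qS]] := enum_card_le Scard Sn.
  exists q; split => [j|j|r Pr gr].
  - by have [] := SP _ (Sq j).
  - by have [_ []] := SP _ (Sq j).
  - have [|r' Sr' rr'] := Scov r; first by split => //; split => //; exact: P_density.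
    by have [j qj] := qS _ Sr'; exists j; rewrite qj.
have [q qP] := choice cov.
have Pq i j : P (q i j) by have [] := qP i.
have qd i j : is_density mu (q i j) := P_density _ (Pq i j).
pose c (s : n.-tuple T) := sel mu m g i0 s.
have mc i : measurable_fun [set: n.-tuple T] (fun s => c s == i).
  exact: measurable_sel.
exists (fun s => prog_mixture m m (q (c s)) s); split.
  split; last by move=> s; exact: prog_mixture_density.
  have mc1 i : measurable_fun [set: n.-tuple T * T] (fun z => c z.1 == i).
    exact: measurableT_comp (mc i) measurable_fst.
  apply: (measurable_fun_select mc1 (f := fun i z => prog_mixture m m (q i) z.1 z.2)).
  by move=> i; have h := measurable_prog_mixture (n := n) m m (qd i); exact: h.
move=> ps Pps d' Omega Q X iidX.
have dps := P_density _ Pps.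
have [x0 _] : exists x : T, True.
  apply: contrapT => noT.
  have [_ _ p1] := dps; have : (\int[mu]_x (ps x)%:E = 0)%E.
    by apply: integral0_eq => x _; case: noT; exists x.
  by rewrite p1 => /eqP; rewrite onee_eq0.
(* [i1] depends on the unknown density; it occurs in the analysis only, never in the estimator. *)
have [i1 gi1] := gnet _ Pps.
pose v i := hellinger_sq mu (g i1) (g i) / eps ^+ 2.
have e20 : 0 < eps ^+ 2 by exact: exprn_gt0.
have v0 i : 0 <= v i by apply: divr_ge0; [exact: hsq_ge0|exact: ltW].
have near i : hellinger_sq mu (g i) ps <= (2 + 2 * v i) * eps ^+ 2.
  have := hsq_quasi_triangle (gd i) (gd i1) dps.
  rewrite (hsqC mu (g i) (g i1)) (hsqC mu (g i1) ps).
  have -> : hellinger_sq mu (g i1) (g i) = v i * eps ^+ 2 by rewrite /v divfK // gt_eqF.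
  by lra.
have domi i : exists j, forall x, ps x <= alpha * (2 + 2 * v i) * q i j x.
  have [_ _ qc] := qP i.
  exact: (cover_dominates P_density P_convex (v0 i) (Pg i) Pps (near i) qc).
have [j0 psq] := choice domi.
(* One constant above all the factors [alpha * (2 + 2 * v i)], as the second stage asks for. Its
   size is immaterial: the divergence bound below uses the individual factors. *)
pose A := 1 + \sum_i alpha * (2 + 2 * v i).
have t0 i : 0 <= alpha * (2 + 2 * v i).
  by have := v0 i => vi; apply: mulr_ge0; lra.
have A1 : 1 <= A by rewrite lerDl sumr_ge0.
have psA i y : ps y <= A * q i (j0 i) y.
  apply: (le_trans (psq i y)); apply: ler_wpM2r; first exact: dens_ge0 (qd i _) y.
  rewrite /A (bigD1 i) //= addrCA lerDl addr_ge0 // sumr_ge0 //.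
have mmn : (m + m <= n)%N by rewrite nE.
have mn : (m <= n)%N by rewrite nE leq_addr.
have c_prefix (s s' : n.-tuple T) :
    (forall i : 'I_n, (i < m)%N -> tnth s i = tnth s' i) -> c s = c s'.
  move=> e; rewrite /c /sel; congr sel_of; apply/funext => i; apply/funext => j.
  by rewrite /beaten /test_prod; congr (_ <= _); apply: eq_bigr => k km; rewrite e.
apply: (le_trans (prog_mixture_risk x0 dps iidX mmn NS_ge1 mc c_prefix qd A1 psA)).
rewrite lee_fin [m%:R + 1]natr1 lerD2r.
have g_card j := separated_ball_card P_density eps_gt0 entV j Pg gsep (Pg i1).
have := first_stage_risk x0 dps iidX mn i0 gd eps_gt0 gi1 M1 g_card.
rewrite -/v -/c => risk.
pose tX w : n.-tuple T := [tuple X i w | i < n].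
have mcX i : measurable_fun [set: Omega] (fun w => c (tX w) == i).
  exact: measurableT_comp (mc i) (measurable_sample X).
have la : 0 <= ln alpha by apply: ln_ge0; lra.
have ea0 : 0 <= eps ^+ 2 * ln alpha by rewrite mulr_ge0 // ltW.
apply: (@le_trans _ _ (eps ^+ 2 * ln alpha *
    \int[Q]_w risk_profile (v (c (tX w))))).
  have ir := integrable_select mcX Q (fun i => risk_profile (v i)).
  rewrite -RintegralZl //; apply: le_RintegralT.
  - exact: (integrable_select mcX Q
      (fun i => \int[mu]_y (ps y * ln (ps y / q i (j0 i) y)))).
  - exact: intbleZ.
  move=> w; set i := c (tX w); have [_ gq _] := qP i.
  exact: (cover_kl_le alpha_ge2 (v0 i) (gd i) (qd i (j0 i)) dps (near i) (gq _) (psq i)).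
apply: (le_trans (ler_wpM2l ea0 risk)).
rewrite -[leRHS]mulrA [leLHS]mulrC; apply: ler_wpM2r => //.
by apply: le_trans le_366609; rewrite /risk_profile; lra.
Qed.
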